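(* Assume the standing setting described in the context, with $p_0>0$. If $\alpha_0<1$, there exists $C>0$ such that $$G(x)\underset{x\to0}{\sim}C\,x^{\mu-\alpha_0}.$$ If $\alpha_0\ge1$, there exists $C>0$ such that $$G(x)\underset{x\to0}{\sim}C\,x^{\mu-1}.$$
   Context: Standing setting. (1) The fragmentation coefficient is $b(x,y)=B(x)\frac1x\,p\!\left(\frac yx\right)$ for $x\ge y\ge0$, $x>0$, where $B:(0,+\infty)\to(0,+\infty)$ is locally integrable and $p$ is a nonnegative finite measure on $[0,1]$ (written as a function; integrals include the endpoints) with $\int_0^1 z\,p(z)\,dz=1$ and $\int_0^1p(z)\,dz>1$. Thus $\int_0^x b(x,y)f(y)\,dy=B(x)\int_0^1 f(xz)\,p(z)\,dz$ and $\int_x^\infty b(y,x)g(y)\,dy=\int_0^1 B(x/z)\,g(x/z)\,p(z)\,\frac{dz}{z}$. (2) $\tau:(0,+\infty)\to(0,+\infty)$ is continuous. (3) For some constants $B_0,B_\infty,\tau_0,\tau_\infty>0$ and $\gamma_0,\gamma,\alpha_0,\alpha\in\mathbb{R}$: $B(x)\sim B_0x^{\gamma_0}$ and $\tau(x)\sim\tau_0x^{\alpha_0}$ as $x\to0$; $B(x)\sim B_\infty x^{\gamma}$ and $\tau(x)\sim\tau_\infty x^{\alpha}$ as $x\to+\infty$; and $\gamma_0-\alpha_0+1>0$, $\gamma-\alpha+1>0$. (4) There exist $p_0\ge0$ and $\mu>0$ with $p(z)=p_0z^{\mu-1}+o(z^{\mu-1})$ as $z\to0$ (in particular $p$ coincides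 with a function near $0$), and $\mu-\alpha_0+1>0$. Profiles. Let $\mathcal{L}g(x)=\int_x^\infty b(y,x)g(y)\,dy-B(x)g(x)$. Under (1)–(4) it is known that there is a unique solution $(\lambda,G,\phi)$, with $\lambda>0$ (the largest eigenvalue of $g\mapsto-(\tau g)'+\mathcal{L}g$), of the eigenproblem $$(\tau G)'+\lambda G=\mathcal{L}G,\quad \tau(x)G(x)\big|_{x=0}=0,\quad G\ge0,\quad \int_0^\infty G\,dx=1,$$ $$-\tau\phi'+(B+\lambda)\phi=\int_0^x b(x,y)\phi(y)\,dy,\quad \phi\ge0,\quad\int_0^\infty G\phi\,dx=1 .$$ $\lambda$, $G$, $\phi$ always denote this solution. *)

(* Defs.v *)
From HB Require Import structures.
From mathcomp Require Import all_boot all_order all_algebra.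
From mathcomp Require Import all_classical all_reals all_analysis.

Set Implicit Arguments.
Unset Strict Implicit.
Unset Printing Implicit Defensive.

Import Order.TTheory GRing.Theory Num.Theory.
Import numFieldNormedType.Exports.

Local Open Scope classical_set_scope.
Local Open Scope ring_scope.

(* Functions on (0, +oo) are represented by total functions R -> R of which
   only the values at positive reals matter.  The measure p on [0, 1] is a
   finite Borel measure on R carried by [0, 1]. *)

(* Lets the asymptotic notations be used at +oo. *)
Canonical pinfty_filter_on (R : numFieldType) :=
  FilterType (pinfty_nbhs R) (@filter_filter _ _ proper_pinfty_nbhs).

Definition abs_continuous (R : realType) (a b : R) (F : R -> R) : Prop :=
  forall e : R, 0 < e -> exists2 d : R, 0 < d &
  forall (n : nat) (u v : nat -> R),
    (forall i, (i < n)%N -> a <= u i /\ u i <= v i /\ v i <= b) ->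
    trivIset `I_n (fun i => [set` `]u i, v i[]) ->
    \sum_(i < n) (v i - u i) < d ->
    \sum_(i < n) `|F (v i) - F (u i)| < e.

Definition locally_abs_continuous (R : realType) (F : R -> R) : Prop :=
  forall a b : R, 0 < a -> a <= b -> abs_continuous a b F.

(* int_x^oo b(y,x) g(y) dy = int_0^1 B(x/z) g(x/z) p(z) dz/z.
   It may be +oo.  At z = 0 the integrand is 0 because 0^-1 = 0; this is
   harmless, as p has no atom at 0 in the setting below. *)
Definition frag_gain (R : realType) (B : R -> R)
    (p : {finite_measure set (measurableTypeR R) -> \bar R})
    (g : R -> R) (x : R) : \bar R :=
  (\int[p]_(z in `[0%R, 1%R]) (B (x / z) * g (x / z) / z)%:E)%E.

Definition frag_op (R : realType) (B : R -> R)
    (p : {finite_measure set (measurableTypeR R) -> \bar R})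
    (g : R -> R) (x : R) : \bar R :=
  (frag_gain B p g x - (B x * g x)%:E)%E.

(* int_0^x b(x,y) f(y) dy = B(x) int_0^1 f(xz) p(z) dz *)
Definition frag_dual_gain (R : realType) (B : R -> R)
    (p : {finite_measure set (measurableTypeR R) -> \bar R})
    (f : R -> R) (x : R) : \bar R :=
  ((B x)%:E * \int[p]_(z in `[0%R, 1%R]) (f (x * z))%:E)%E.

(* Near 0 the measure p has a density q with
   q(z) = p0 z^(mu-1) + o(z^(mu-1)) as z -> 0. *)
Definition power_density_at0 (R : realType)
    (p : {finite_measure set (measurableTypeR R) -> \bar R})
    (p0 mu : R) : Prop :=
  exists2 e : R, 0 < e & exists q : R -> R,
    [/\ measurable_fun (`[0, e[ : set R) q,
        forall z : R, 0 <= z < e -> 0 <= q z,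
        forall A : set R, measurable A -> A `<=` `[0, e[ ->
          p A = (\int[lebesgue_measure]_(z in A) (q z)%:E)%E &
        q = (fun z => p0 * z `^ (mu - 1)) +o_ (0^'+) (fun z => z `^ (mu - 1))].

Record growth_frag_setting (R : realType) (B tau : R -> R)
    (p : {finite_measure set (measurableTypeR R) -> \bar R})
    (B0 Binf tau0 tauinf gamma0 gamma alpha0 alpha p0 mu : R) : Prop := {
  gf_B_gt0 : forall x : R, 0 < x -> 0 < B x;
  gf_B_loc : locally_integrable `]0, +oo[ B;
  gf_p_supp : p (~` (`[0%R, 1%R] : set R)) = 0%E;
  gf_p_mean : (\int[p]_(z in `[0%R, 1%R]) z%:E = 1)%E;
  gf_p_mass : (1 < p (`[0%R, 1%R]%classic : set R))%E;
  gf_tau_gt0 : forall x : R, 0 < x -> 0 < tau x;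
  gf_tau_cont : forall x : R, 0 < x -> {for x, continuous tau};
  gf_B0_gt0 : 0 < B0;
  gf_Binf_gt0 : 0 < Binf;
  gf_tau0_gt0 : 0 < tau0;
  gf_tauinf_gt0 : 0 < tauinf;
  gf_B_at0 : B ~_ (0^'+) (fun x => B0 * x `^ gamma0);
  gf_tau_at0 : tau ~_ (0^'+) (fun x => tau0 * x `^ alpha0);
  gf_B_aty : B ~_ (+oo) (fun x => Binf * x `^ gamma);
  gf_tau_aty : tau ~_ (+oo) (fun x => tauinf * x `^ alpha);
  gf_exp_at0 : 0 < gamma0 - alpha0 + 1;
  gf_exp_aty : 0 < gamma - alpha + 1;
  gf_p0_ge0 : 0 <= p0;
  gf_mu_gt0 : 0 < mu;
  gf_p_at0 : power_density_at0 p p0 mu;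
  gf_mu_alpha0 : 0 < mu - alpha0 + 1
}.

(* Since B is only locally integrable and p is a measure, the two equations are
   understood in the Caratheodory sense: the differentiated functions tau G and
   phi are locally absolutely continuous on (0, +oo) and the equations hold for
   almost every x > 0.  Both are stated in \bar R, with a finite left-hand side,
   so that they include the finiteness of the integral terms. *)
Record eigen_solution (R : realType) (B tau : R -> R)
    (p : {finite_measure set (measurableTypeR R) -> \bar R})
    (lambda : R) (G phi : R -> R) : Prop := {
  es_lambda_gt0 : 0 < lambda;
  es_G_ac : locally_abs_continuous (fun x => tau x * G x);
  es_G_eq : {ae lebesgue_measure, forall x : R, 0 < x ->
    derivable (fun y => tau y * G y) x 1 /\
    (derive1 (fun y => tau y * G y) x + lambda * G x)%:E = frag_op B p G x};
  es_G_at0 : (tau x * G x) @[x --> 0^'+] --> (0 : R);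
  es_G_ge0 : forall x : R, 0 < x -> 0 <= G x;
  es_G_mass :
    (\int[lebesgue_measure]_(x in `]0%R, +oo[) (G x)%:E = 1)%E;
  es_phi_ac : locally_abs_continuous phi;
  es_phi_eq : {ae lebesgue_measure, forall x : R, 0 < x ->
    derivable phi x 1 /\
    (- (tau x * derive1 phi x) + (B x + lambda) * phi x)%:E
      = frag_dual_gain B p phi x};
  es_phi_ge0 : forall x : R, 0 < x -> 0 <= phi x;
  es_phi_mass :
    (\int[lebesgue_measure]_(x in `]0%R, +oo[) (G x * phi x)%:E = 1)%E
}.

(* Main.v *)
Require Import Defs.
From HB Require Import structures.
From mathcomp Require Import all_boot all_order all_algebra.
From mathcomp Require Import all_classical all_reals all_analysis.
From mathcomp Require Import measurable_realfun.
From mathcomp Require Import ring lra.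

(** Write F = tau G and h = B G = (B / tau) F. Almost everywhere on (0, +oo),

      F' + A F = N,   A = (lambda + B) / tau,   N(x) = int_0^1 h(x/z) p(z) dz / z.

    The proof consists in finding the size of N at 0 and then solving this linear
    equation asymptotically.

    Size of N. For small z the density is about p0 z^(mu-1), and the substitution
    y = x / z turns the corresponding part of N(x) into p0 x^(mu-1) times the moment
    of h of order - mu over the sizes y larger than a multiple of x [gain_scaling].
    The remaining fragments come from sizes comparable with x and contribute at most
    a constant times the size of h there [gain_mid_le]. If the whole moment

      I = int_0^oo y^(-mu) h(y) dy

    is finite and h = O(x^(dl-1+mu)) with dl > 0, then N is equivalent to
    p0 I x^(mu-1) [gain_equivalent], and I > 0 because G does not vanish identically.

    Finiteness of I. At infinity it follows from the equation itself: N is finite at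
    almost every small x, and since p0 > 0 a finite gain bounds the moment away from 0
    [truncated_moment_lty]. At 0 it follows from the a priori bound F = O(x^mu)
    [profile_le_powR], because B / tau = O(x^(dl-1)) with dl > 0. To prove that bound,
    let S be the best constant in F <= S (x^mu + a) on (0, r], which is finite because
    F tends to 0. Inserted in N, it gives a right-hand side in which S is multiplied
    by a small power of r, and F' <= N integrates to S <= const + S / 2 with a
    constant independent of a; then a tends to 0.

    Solving the equation. If (x^beta)' + A x^beta is equivalent to m x^(mu-1), then
    multiples of x^beta slightly above and below p0 I / m are super- and subsolutions
    near 0, so that F is equivalent to (p0 I / m) x^beta [linear_ode_equivalent]. For
    alpha0 < 1 one takes beta = mu and m = mu; for alpha0 >= 1, beta = mu - 1 + alpha0
    and m = lambda / tau0, plus mu if alpha0 = 1. Dividing by tau gives G.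

    The equation holds only almost everywhere, and h need not be continuous: all
    comparisons rest on the fact that an absolutely continuous function whose
    derivative is nonnegative almost everywhere is nondecreasing
    [ac_ae_derive_ge0_le]. *)

Set Implicit Arguments.
Unset Strict Implicit.
Unset Printing Implicit Defensive.

Import Order.TTheory GRing.Theory Num.Theory.
Import numFieldNormedType.Exports.

Local Open Scope classical_set_scope.
Local Open Scope ring_scope.

(** * Monotonicity of absolutely continuous functions *)

(** Real induction on [a, b]: the supremum of T cannot be below b, because a step
    that starts just before it ends just after it. *)
Lemma creeping_induction (R : realType) (a b : R) (T : set R) :
  a <= b -> T a ->
  (forall s, a <= s <= b -> exists2 eta, 0 < eta &
    forall t u, a <= t -> s - eta < t <= s -> s <= u <= b -> u < s + eta ->
      T t -> T u) ->
  T b.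
Proof.
move=> ab Ta step.
pose E := [set t | T t /\ a <= t <= b].
have Ea : E a by split; rewrite ?lexx.
have ubE : has_ubound E by exists b => t [_ /andP[]].
have supE : has_sup E by split => //; exists a.
have asup : a <= sup E by exact: ub_le_sup.
have supb : sup E <= b by apply: sup_le_ub; [exists a|move=> t [_ /andP[]]].
have [|eta eta0 stp] := step (sup E); first by rewrite asup supb.
have [t [Tt /andP[at_ tb]] st] := sup_adherent eta0 supE.
have ts : t <= sup E by apply: ub_le_sup => //; split=> //; rewrite at_ tb.
pose u := Num.min b (sup E + eta / 2).
have su : sup E <= u by rewrite le_min supb lerDl divr_ge0// ltW.
have ub : u <= b by rewrite ge_min lexx.
have Tu : T u.
  apply: (stp t u) => //; [by rewrite st ts|by rewrite su ub|].
  rewrite gt_min; apply/orP; right; rewrite ltrD2l ltr_pdivrMr//.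
  by rewrite ltr_pMr// ltr1n.
have us : u <= sup E by apply: ub_le_sup => //; split => //; rewrite ub (le_trans asup).
have [bs|bs] := leP b (sup E + eta / 2).
  by move: Tu; rewrite /u (min_idPl bs).
by move: us; rewrite /u (min_idPr (ltW bs)) leNgt ltrDl divr_gt0.
Qed.

Lemma derive_ge0_near (R : realType) (f : R -> R) (s e : R) : 0 < e ->
  derivable f s 1 -> 0 <= derive1 f s ->
  exists2 eta, 0 < eta & forall t u, s - eta < t <= s -> s <= u < s + eta ->
    f t - f u <= e * (u - t).
Proof.
move=> e0 df f0.
have := df; rewrite /derivable => /cvgrPdist_lt /(_ e e0).
rewrite -/('D_1 f s) -derive1E => -[eta /= eta0 H].
have K (h : R) : `|h| < eta -> h != 0 -> - e < h^-1 * (f (s + h) - f s).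
  move=> heta h0; have := H h; rewrite /ball/= sub0r normrN => /(_ heta h0).
  rewrite /GRing.scale/= mulr1 (addrC h) => /ltr_distlBl; apply: le_lt_trans.
  by rewrite lerBrDr addNr.
exists eta => // t u /andP[ht ts] /andP[su hu].
have A : f t - f s <= e * (s - t).
  have [->|tns] := eqVneq t s; first by rewrite !subrr mulr0.
  have ts' : t < s by rewrite lt_neqAle tns.
  have := K (t - s); rewrite subr_eq0 (_ : s + (t - s) = t); last by rewrite addrC subrK.
  rewrite ltr0_norm ?subr_lt0// opprB ltrBlDr -ltrBlDl ht => /(_ isT tns).
  rewrite mulrC ltr_ndivlMr ?subr_lt0//.
  by rewrite -(opprB s t) mulrNN => /ltW.
have B : f s - f u <= e * (u - s).
  have [->|uns] := eqVneq u s; first by rewrite !subrr mulr0.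
  have su' : s < u by rewrite lt_neqAle eq_sym uns.
  have := K (u - s); rewrite subr_eq0 (_ : s + (u - s) = u); last by rewrite addrC subrK.
  rewrite gtr0_norm ?subr_gt0// ltrBlDl hu => /(_ isT uns).
  rewrite mulrC ltr_pdivlMr ?subr_gt0//.
  by rewrite mulNr -[f u - f s]opprB ltrN2 => /ltW.
have -> : f t - f u = (f t - f s) + (f s - f u) by rewrite addrA subrK.
by rewrite (le_trans (lerD A B))// -mulrDr (addrC (s - t)) addrA subrK.
Qed.

Lemma sum_length_disjoint_le (R : realType) (n : nat) (u v : nat -> R) (U : set R) :
  measurable U -> (forall i, (i < n)%N -> u i <= v i) ->
  trivIset `I_n (fun i => [set` `]u i, v i[]) ->
  (forall i, (i < n)%N -> [set` `]u i, v i[] `<=` U) ->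
  ((\sum_(i < n) (v i - u i))%:E <= lebesgue_measure U)%E.
Proof.
move=> mU uv tI sU.
have mI k : measurable ([set` `]u k, v k[] : set R) by exact: measurable_itv.
have mB : measurable (\big[setU/set0]_(k < n) ([set` `]u k, v k[] : set R)).
  by apply: bigsetU_measurable.
have : (lebesgue_measure (\big[setU/set0]_(k < n) ([set` `]u k, v k[] : set R))
    <= lebesgue_measure U)%E.
  apply: le_measure; rewrite ?inE// => x.
  rewrite -(@bigcup_mkord _ n (fun k => [set` `]u k, v k[] : set R)).
  by move=> -[i /= ni]; exact: sU.
apply: le_trans.
rewrite (@measure_semi_additive_ord_I _ _ _ lebesgue_measure
  (fun k => [set` `]u k, v k[] : set R))//.
rewrite -sumEFin le_eqVlt; apply/orP; left; apply/eqP/eq_bigr => i _.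
rewrite [RHS](lebesgue_measure_itv `]u i, v i[)/= lte_fin.
case: ltgtP (uv i (ltn_ord i)) => // -> _; by rewrite subrr.
Qed.

(** The derivative condition fails on a null set only; cover that set by an open
    set U of small measure and creep from a to b: near a point outside U the
    function loses at most e times the length of the step, and the steps inside U
    are disjoint intervals of small total length, over which absolute continuity
    bounds the total loss. *)
Lemma ac_ae_derive_ge0_le (R : realType) (a b : R) (f : R -> R) :
  a <= b -> abs_continuous a b f ->
  {ae lebesgue_measure, forall x : R, a < x < b ->
     derivable f x 1 /\ 0 <= derive1 f x} ->
  f a <= f b.
Proof.
move=> ab acf [N [mN N0 subN]].
apply/ler_addgt0Pr => eps eps0.
pose e := eps / 2 / (1 + (b - a)).
have ba1 : 0 < 1 + (b - a) by rewrite ltr_pwDl// subr_ge0.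
have e0 : 0 < e by rewrite !divr_gt0.
have eps20 : 0 < eps / 2 by rewrite divr_gt0.
have [d d0 Hd] := acf (eps / 2) eps20.
(* The endpoints, where nothing is known about the derivative, join the bad set. *)
pose N' := N `|` [set a] `|` [set b].
have mN' : measurable N' by apply: measurableU => //; exact: measurableU.
have N'0 : lebesgue_measure N' = 0.
  have z c : lebesgue_measure.-negligible ([set c] : set R).
    by exists [set c]; split => //; exact: lebesgue_measure_set1.
  apply: measure_negligible => //; apply: negligibleU => //.
  by apply: negligibleU => //; exists N; split.
have [|U [oU N'U muU]] := @lebesgue_regularity_outer R N' d mN' _ d0.
  by rewrite [X in (X < _)%E]N'0 ltry.
have mU : measurable U by exact: open_measurable.
have {}muU : (lebesgue_measure U < d%:E)%E.
  apply: le_lt_trans muU.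
  have := measureU2 lebesgue_measure (measurableD mU mN') mN'.
  by rewrite [X in (_ <= _ + X)%E -> _]N'0 adde0 setDKU.
(* The points reached from a with a loss bounded by the steps made so far; the
   intervals ]u i, v i[ are the steps inside U. *)
pose T := [set x | exists n (u v : nat -> R),
  [/\ forall i, (i < n)%N -> a <= u i /\ u i <= v i /\ v i <= x,
      trivIset `I_n (fun i => [set` `]u i, v i[]),
      forall i, (i < n)%N -> [set` `]u i, v i[] `<=` U &
      f a - f x <= e * (x - a) + \sum_(i < n) `|f (v i) - f (u i)|]].
suff : T b.
  move=> [n [u [v [uv tI sU]]]].
  have /Hd : (forall i, (i < n)%N -> a <= u i /\ u i <= v i /\ v i <= b) by [].
  move=> /(_ tI) H.
  have : \sum_(i < n) (v i - u i) < d.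
    rewrite -lte_fin; apply: le_lt_trans muU.
    by apply: sum_length_disjoint_le => // i /uv [_ []].
  move=> {}/H H.
  have eb : e * (b - a) <= eps / 2.
    rewrite /e -mulrA ger_pMr ?divr_gt0//.
    by rewrite mulrC ler_pdivrMr// mul1r lerDr.
  by move=> H2; lra.
apply: (@creeping_induction _ a b T) => //.
  exists 0%N, (fun=> a), (fun=> a); split => //.
  by rewrite big_ord0 !subrr mulr0 addr0.
move=> s /andP[as_ sb].
have [sU|sU] := pselect (U s).
- have /nbhs_ballP [eta /= eta0 sub] : nbhs s U by exact: open_nbhs_nbhs.
  exists eta => // t u at_ /andP[st ts] /andP[su ub] us [n [x [y [xy tI sxy H]]]].
  exists n.+1, (fun i => if (i < n)%N then x i else t),
    (fun i => if (i < n)%N then y i else u); split.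
  + move=> i _; case: ifPn => [/xy[? [? yt]]|_].
      by do 2 (split => //); rewrite (le_trans yt)// (le_trans ts).
    by rewrite at_ lexx (le_trans ts).
  + move=> i j /= ni nj [z []].
    have D k w : (k < n)%N -> z \in `]x k, y k[ -> z \in `]t, w[ -> False.
      move=> /xy[_ [_ yt]]; rewrite !in_itv/= => /andP[_ zy] /andP[tz _].
      by have := lt_trans tz (lt_le_trans zy yt); rewrite ltxx.
    case: ifPn => hi; case: ifPn => hj.
    * by move=> A B; apply: tI => //; exists z.
    * by move=> A B; exfalso; exact: (D i u).
    * by move=> A B; exfalso; exact: (D j u).
    * move=> _ _; move: ni nj hi hj; rewrite -!leqNgt !ltnS => i1 j1 i2 j2.
      by apply/eqP; rewrite eqn_leq (leq_trans i1 j2) (leq_trans j1 i2).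
  + move=> i _; case: ifPn => [/sxy//|_] z; rewrite /= in_itv/= => /andP[tz zu].
    apply: sub; rewrite /ball/= ltr_distlC; apply/andP; split; lra.
  + rewrite big_ord_recr/= ltnn.
    under eq_bigr do rewrite ltn_ord.
    have := ler_norm (f t - f u); rewrite -normrN opprB => ftu.
    have : 0 <= e * (u - t) by rewrite mulr_ge0 ?(ltW e0)// subr_ge0 (le_trans ts).
    by move: H; rewrite !mulrBr; lra.
- have [asb dfs] : a < s < b /\ (derivable f s 1 /\ 0 <= derive1 f s).
    have ns : ~ N' s by move=> /N'U.
    have asb : a < s < b.
      rewrite !lt_neqAle as_ sb !andbT; apply/andP; split; apply/eqP => E; apply: ns.
        by left; right.
      by right.
    split => //; apply: contrapT => H; apply: ns; left; left; apply: subN => /= H'.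
    exact/H/H'.
  have [eta eta0 H] := derive_ge0_near e0 dfs.1 dfs.2.
  exists eta => // t u at_ /andP[st ts] /andP[su ub] us [n [x [y [xy tI sxy H1]]]].
  exists n, x, y; split => //.
    move=> i /xy [? [? yt]]; do 2 (split => //).
    by rewrite (le_trans yt)// (le_trans ts).
  have := H t u; rewrite st ts su us => /(_ isT isT).
  by move: H1; rewrite !mulrBr; lra.
Qed.

(** * Comparison with powers *)

Lemma ae_imply (R : realType) (P Q : R -> Prop) :
  (forall x, P x -> Q x) ->
  {ae lebesgue_measure, forall x : R, P x} ->
  {ae lebesgue_measure, forall x : R, Q x}.
Proof.
move=> PQ [N [mN N0 PN]]; exists N; split => //.
by apply: subset_trans PN; apply: subsetC => x; exact: PQ.
Qed.

Lemma near0P (R : realType) (P : R -> Prop) :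
  (\forall x \near 0^'+, P x) <->
  exists2 r : R, 0 < r & forall x, 0 < x <= r -> P x.
Proof.
split=> [[r /= r0 H]|[r r0 H]].
  exists (r / 2) => [|x /andP[x0 xr]]; first by rewrite divr_gt0.
  apply: H => //=; rewrite sub0r normrN gtr0_norm//.
  by rewrite (le_lt_trans xr)// ltr_pdivrMr// ltr_pMr// ltr1n.
near=> x; apply: H; apply/andP; split; near: x.
- exact: nbhs_right_gt.
- exact: nbhs_right_le.
Unshelve. all: by end_near. Qed.

Lemma ac_continuous (R : realType) (F : R -> R) (x : R) :
  locally_abs_continuous F -> 0 < x -> {for x, continuous F}.
Proof.
move=> acF x0; apply/cvgrPdist_lt => e e0.
have [||d d0 H] := acF (x / 2) (x * 2) _ _ e e0; first by rewrite divr_gt0.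
  by rewrite ler_pdivrMr// -mulrA ler_peMr ?(ltW x0)//; lra.
pose rho := Num.min d (x / 2).
have rho0 : 0 < rho by rewrite lt_min d0 divr_gt0.
exists rho => //= y; rewrite /ball/= /rho lt_min => /andP[xyd xyx].
have xy : x / 2 <= Num.min x y /\ Num.max x y <= x * 2.
  move: xyx; rewrite ltr_distlC => /andP[? ?].
  by rewrite le_min ge_max; split; apply/andP; split; lra.
have := H 1%N (fun=> Num.min x y) (fun=> Num.max x y).
rewrite !big_ord1 => /(_ _ _ _).
have -> : `|F (Num.max x y) - F (Num.min x y)| = `|F x - F y|.
  by case: leP => _ //; rewrite distrC.
have -> : Num.max x y - Num.min x y = `|x - y|.
  have [xy'|xy'] := leP x y; first by rewrite ler0_norm ?subr_le0// opprB.
  by rewrite gtr0_norm// subr_gt0.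
apply => //; first by move=> i _; rewrite xy.1 xy.2 ge_min le_max lexx.
by move=> [|i] [|j].
Qed.

Lemma abs_continuousD (R : realType) (a b : R) (f g : R -> R) :
  abs_continuous a b f -> abs_continuous a b g ->
  abs_continuous a b (fun x => f x + g x).
Proof.
move=> af ag e e0; have e20 : 0 < e / 2 by rewrite divr_gt0.
have [d1 d10 H1] := af _ e20; have [d2 d20 H2] := ag _ e20.
exists (Num.min d1 d2) => [|n u v uv tI]; first by rewrite lt_min d10.
rewrite lt_min => /andP[/(H1 _ _ _ uv tI) A /(H2 _ _ _ uv tI) B].
rewrite (splitr e); apply: le_lt_trans (ltrD A B).
rewrite -big_split/=; apply: ler_sum => i _.
by rewrite opprD addrACA ler_normD.
Qed.

Lemma abs_continuousN (R : realType) (a b : R) (f : R -> R) :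
  abs_continuous a b f -> abs_continuous a b (fun x => - f x).
Proof.
move=> af e /af[d d0 H]; exists d => // n u v uv tI /(H _ _ _ uv tI).
by apply: le_lt_trans; apply: ler_sum => i _; rewrite -opprD normrN.
Qed.

Lemma lipschitz_abs_continuous (R : realType) (a b k : R) (f : R -> R) :
  0 <= k ->
  (forall u v, a <= u -> u <= v -> v <= b -> `|f v - f u| <= k * (v - u)) ->
  abs_continuous a b f.
Proof.
move=> k0 lip e e0; have k1 : 0 < k + 1 by rewrite ltr_wpDl.
exists (e / (k + 1)) => [|n u v uv _]; first by rewrite divr_gt0.
rewrite ltr_pdivlMr// => H.
have S0 : 0 <= \sum_(i < n) (v i - u i).
  by apply: sumr_ge0 => i _; rewrite subr_ge0; have [_ []] := uv i (ltn_ord i).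
have : \sum_(i < n) `|f (v i) - f (u i)| <= k * \sum_(i < n) (v i - u i).
  rewrite mulr_sumr; apply: ler_sum => i _.
  by have [? [? ?]] := uv i (ltn_ord i); exact: lip.
move=> /le_lt_trans; apply; move: H; lra.
Qed.

(** The mean value theorem gives a Lipschitz constant; the sum of the two endpoint
    values bounds x^(s - 1) whether this power increases or decreases. *)
Lemma locally_ac_powR (R : realType) (c s : R) :
  locally_abs_continuous (fun x => c * x `^ s).
Proof.
move=> a b a0 ab.
pose k := `|c * s| * (a `^ (s - 1) + b `^ (s - 1)).
have b0 : 0 < b by exact: lt_le_trans ab.
have dv (x : R) : 0 < x -> is_derive x 1 (fun x => c * x `^ s) (c * (s * x `^ (s - 1))).
  by move=> x0; apply: is_deriveZ; exact: is_derive1_powR.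
apply: (@lipschitz_abs_continuous _ _ _ k).
  by rewrite mulr_ge0// addr_ge0// powR_ge0.
move=> u v au; rewrite le_eqVlt => /predU1P[->|uv] vb.
  by rewrite !subrr normr0 mulr0.
have u0 : 0 < u by exact: lt_le_trans au.
have [||x] := @MVT R (fun x => c * x `^ s) (fun x => c * (s * x `^ (s - 1))) u v uv.
- by move=> x; rewrite in_itv/= => /andP[ux _]; apply: dv; exact: lt_trans ux.
- apply: derivable_within_continuous => x; rewrite in_itv/= => /andP[ux _].
  by have [] := dv x (lt_le_trans u0 ux).
rewrite in_itv/= => /andP[ux xv] ->.
have x0 : 0 < x by exact: lt_trans ux.
rewrite normrM (gtr0_norm (_ : 0 < v - u)) ?subr_gt0//.
rewrite ler_wpM2r ?subr_ge0 ?(ltW uv)// mulrA normrM ler_wpM2l//.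
rewrite ger0_norm ?powR_ge0//.
have [s1|s1] := leP 0 (s - 1).
  apply: ler_wpDl; rewrite ?powR_ge0//.
  apply: ge0_ler_powR => //; rewrite ?nnegrE ?(ltW x0) ?(ltW b0)//.
  exact: le_trans (ltW xv) vb.
apply: ler_wpDr; rewrite ?powR_ge0//.
rewrite -(opprK (s - 1)) !(powRN _ (- (s - 1))) lef_pV2 ?posrE ?powR_gt0//.
apply: ge0_ler_powR => //; rewrite ?nnegrE ?(ltW x0) ?(ltW a0)//.
  by rewrite oppr_ge0 ltW.
exact: le_trans au (ltW ux).
Qed.

(** A negative value of D would be reached, after the last point where D is still
    above half of it, along an interval on which D is nondecreasing. *)
Lemma comparison_ge0 (R : realType) (r : R) (D : R -> R) :
  locally_abs_continuous D -> D x @[x --> 0^'+] --> (0 : R) ->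
  {ae lebesgue_measure, forall x, 0 < x < r -> D x < 0 ->
    derivable D x 1 /\ 0 <= derive1 D x} ->
  forall x, 0 < x <= r -> 0 <= D x.
Proof.
move=> acD D0 dD x /andP[x0 xr]; rewrite leNgt; apply/negP => Dx.
have [y0 /andP[y00 y0x] Dy0] : exists2 y, 0 < y < x & D x / 2 <= D y.
  move/cvgrPdist_le : D0 => /(_ (- D x / 2)) [|d /= d0 H].
    by rewrite divr_gt0// oppr_gt0.
  pose y := Num.min (d / 2) (x / 2).
  have y0 : 0 < y by rewrite lt_min !divr_gt0.
  have yx : y < x.
    by rewrite gt_min; apply/orP; right; rewrite ltr_pdivrMr// ltr_pMr// ltr1n.
  exists y; first by rewrite y0.
  have := H y; rewrite /ball/= sub0r normrN gtr0_norm// => /(_ _ y0).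
  have -> : y < d.
    by rewrite gt_min; apply/orP; left; rewrite ltr_pdivrMr// ltr_pMr// ltr1n.
  by move=> /(_ isT); rewrite sub0r normrN mulNr ler_norml opprK => /andP[].
pose E := [set y | y0 <= y <= x /\ D x / 2 <= D y].
have Ey0 : E y0 by split; rewrite // lexx ltW.
have ubE : has_ubound E by exists x => t [/andP[]].
have supE : has_sup E by split => //; exists y0.
pose s := sup E.
have y0s : y0 <= s by exact: ub_le_sup.
have sx : s <= x by apply: sup_le_ub; [exists y0|move=> t [/andP[]]].
have s0 : 0 < s by exact: lt_le_trans y0s.
have Ds : D x / 2 <= D s.
  rewrite leNgt; apply/negP => Ds.
  have /cvgrPdist_lt /(_ (D x / 2 - D s)) := ac_continuous acD s0.
  rewrite subr_gt0 => /(_ Ds)[d /= d0 H].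
  have [t [/andP[y0t tx] Dt] st] := sup_adherent d0 supE.
  have ts : t <= s by apply: ub_le_sup => //; split => //; rewrite y0t.
  have := H t; rewrite /ball/= ger0_norm ?subr_ge0// ltrBlDl -ltrBlDr => /(_ st).
  by rewrite ltr_distlC => /andP[_]; lra.
have acsx : abs_continuous s x D by exact: acD.
have : D s <= D x.
  apply: ac_ae_derive_ge0_le => //; apply: ae_imply dD => t H /andP[st tx].
  apply: H.
    by rewrite (lt_trans s0 st) (lt_le_trans tx).
  rewrite ltNge; apply/negP => Dt.
  suff : t <= s by rewrite leNgt st.
  apply: ub_le_sup => //; split; first by rewrite (le_trans y0s (ltW st)) ltW.
  by apply: le_trans Dt; rewrite ltW// pmulr_llt0.
lra.
Qed.

(** Both sides vanish at 0, so it is enough to control the derivative of F at the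
    points where F is above the powers. Applied to - F it gives lower bounds, since
    c and c' have no sign. *)
Lemma comparison_powR (R : realType) (r : R) (F : R -> R) (c s c' s' : R) :
  0 < s -> 0 < s' ->
  locally_abs_continuous F -> F x @[x --> 0^'+] --> (0 : R) ->
  {ae lebesgue_measure, forall x, 0 < x < r ->
    c * x `^ s + c' * x `^ s' < F x ->
    derivable F x 1 /\
    derive1 F x <= c * (s * x `^ (s - 1)) + c' * (s' * x `^ (s' - 1))} ->
  forall x, 0 < x <= r -> F x <= c * x `^ s + c' * x `^ s'.
Proof.
move=> s0 s'0 acF F0 dF x xr; rewrite -subr_ge0.
pose D y := (c * y `^ s + c' * y `^ s') + - F y.
apply: (@comparison_ge0 R r D) => //.
- move=> a b a0 ab; apply: abs_continuousD; last by apply: abs_continuousN; exact: acF.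
  by apply: abs_continuousD; exact: locally_ac_powR.
- rewrite -[X in _ --> X](addr0 0) -[X in _ --> _ + X]oppr0.
  apply: cvgD; last exact: cvgN.
  rewrite -[X in _ --> X](addr0 0) -[X in _ --> X + _](mulr0 c)
    -[X in _ --> _ + X](mulr0 c').
  by apply: cvgD; (apply: cvgM; [exact: cvg_cst|exact: powR_cvg0]).
- apply: ae_imply dF => y H /[dup] /andP[y0 yr] /H{}H.
  rewrite /D subr_lt0 => /H[dF dF'].
  have dv (k t : R) : is_derive y 1 (fun x => k * x `^ t) (k * (t * y `^ (t - 1))).
    by apply: is_deriveZ; exact: is_derive1_powR.
  have dFy : is_derive y 1 F (derive1 F y) by rewrite derive1E; exact: DeriveDef.
  have dD := is_deriveD (is_deriveD (dv c s) (dv c' s')) (is_deriveN dFy).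
  split; first by case: dD.
  have -> : derive1 D y = _ := etrans (derive1E _ _) (@derive_val _ _ _ _ _ _ _ dD).
  by rewrite subr_ge0.
Qed.

(** * Densities, dilations and tails of powers *)

Section density.
Local Open Scope ereal_scope.
Context d (T : measurableType d) (R : realType).
Variables (mu nu : {measure set T -> \bar R}) (E : set T) (q : T -> R).
Hypotheses (mE : measurable E) (mq : measurable_fun E q)
  (q0 : forall x, E x -> (0 <= q x)%R)
  (nuq : forall A, measurable A -> A `<=` E -> nu A = \int[mu]_(x in A) (q x)%:E).

Import HBNNSimple.

Let integral_density_nnsfun (h : {nnsfun T >-> R}) :
  \int[nu]_(x in E) (h x)%:E = \int[mu]_(x in E) ((h x)%:E * (q x)%:E).
Proof.
have mEq : measurable_fun E (fun x => (q x)%:E) by exact/measurable_EFinP.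
transitivity (\int[nu]_(x in E)
   (\sum_(y \in range h) (y * \1_(h @^-1` [set y]) x)%:E)).
  by apply: eq_integral => t tE; rewrite /= fimfunE -fsumEFin.
have indich r : measurable_fun E (fun x => (r * \1_(h @^-1` [set r]) x)%:E).
  by apply: (measurable_comp measurableT) => //; exact: measurable_funM.
rewrite ge0_integral_fsum//; last by move=> m y Ey; exact: nnfun_muleindic_ge0.
transitivity (\int[mu]_(x in E) (\sum_(y \in range h)
    (y * \1_(h @^-1` [set y]) x)%:E * (q x)%:E)); last first.
  apply: eq_integral => x /[!inE] Ex.
  rewrite -ge0_mule_fsuml => [|y]; last exact: nnfun_muleindic_ge0.
  by rewrite fsumEFin // -(fimfunE _ x).
rewrite ge0_integral_fsum//; last 2 first.
  - by move=> y; apply: emeasurable_funM.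
  - move=> m y Ey; apply: mule_ge0; first exact: nnfun_muleindic_ge0.
    by rewrite lee_fin q0.
apply: eq_fsbigr => r rhn.
have r0 : (0 <= r)%R by move: rhn; rewrite inE => -[t _ <-].
rewrite integralZl_indic_nnsfun => //.
under [RHS]eq_integral do rewrite EFinM -muleA.
rewrite ge0_integralZl//.
- congr (_ * _).
  rewrite [RHS](eq_integral ((fun x => (q x)%:E) \_ (h @^-1` [set r]))); last first.
    by move=> x xE; rewrite epatch_indic/= muleC.
  rewrite -integral_mkcondr -nuq; [|exact: measurableI|by move=> ? []].
  by rewrite integral_indic// setIC.
- by apply: emeasurable_funM => //; exact/measurable_EFinP.
- by move=> t Et; rewrite mule_ge0 ?lee_fin ?q0.
Qed.

(** The equality of the measures on subsets of E passes to simple functions by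
    linearity and to nonnegative functions by monotone convergence. *)
Lemma ge0_integral_density (f : T -> \bar R) : measurable_fun E f ->
  (forall x, E x -> 0 <= f x) ->
  \int[nu]_(x in E) f x = \int[mu]_(x in E) (f x * (q x)%:E).
Proof.
move=> mf f0.
have mEq : measurable_fun E (fun x => (q x)%:E) by exact/measurable_EFinP.
pose h := nnsfun_approx mE mf.
have -> : \int[nu]_(x in E) f x =
    lim (\int[nu]_(x in E) (EFin \o h n) x @[n --> \oo]).
  have fE x : E x -> f x = lim ((EFin \o h n) x @[n --> \oo]).
    by move=> Ex; apply/esym/cvg_lim => //; apply: cvg_nnsfun_approx.
  under eq_integral => x /[!inE] /fE -> //.
  apply: monotone_convergence => //.
  - move=> n; apply/measurable_EFinP.
    by apply: (measurable_funS measurableT) => //; exact/measurable_funP.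
  - by move=> n x Ex //=; rewrite lee_fin.
  - by move=> x Ex a b ab; rewrite lee_fin; exact/lefP/nd_nnsfun_approx.
have -> : \int[mu]_(x in E) (f x * (q x)%:E) =
    lim (\int[mu]_(x in E) ((EFin \o h n) x * (q x)%:E) @[n --> \oo]).
  have fg x : E x -> f x * (q x)%:E = lim (((EFin \o h n) x * (q x)%:E) @[n --> \oo]).
    by move=> Ex; apply/esym/cvg_lim => //; apply: cvgeZr => //;
      apply: cvg_nnsfun_approx.
  under eq_integral => x /[!inE] /fg -> //.
  apply: monotone_convergence => [//| | |].
  - move=> n; apply/emeasurable_funM => //; apply/measurable_funTS.
    exact/measurable_EFinP.
  - by move=> n x Ex /=; rewrite mule_ge0 ?lee_fin ?q0.
  - by move=> x Ex a b ab/=; rewrite lee_wpmul2r ?lee_fin ?q0//; exact/lefP/nd_nnsfun_approx.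
by under eq_fun do rewrite /= integral_density_nnsfun.
Qed.

End density.

Section scaling.
Local Open Scope ereal_scope.
Context (R : realType).
Local Notation leb := (@lebesgue_measure R).

Let mscal (x : R) : measurable_fun [set: measurableTypeR R]
  ( *%R x : measurableTypeR R -> measurableTypeR R).
Proof. exact: (measurable_funM (measurable_cst x)). Qed.

Lemma lebesgue_measure_scale (x : R) (A : set R) : (0 < x)%R -> measurable A ->
  leb A = x%:E * leb ( *%R x @^-1` A).
Proof.
move=> x0 mA.
pose fx : measurableTypeR R -> measurableTypeR R := *%R x.
pose m : {measure set (measurableTypeR R) -> \bar R} :=
  mscale (NngNum (ltW x0)) (pushforward leb fx).
rewrite (@lebesgue_measure_unique R (m (mscal x)))//= => _ [[a b]] _ <-.
rewrite /m /mscale/= /pushforward/=.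
have -> : fx @^-1` `]a, b]%classic = `](a / x)%R, (b / x)%R]%classic.
  apply/seteqP; split => y /=; rewrite !in_itv/= ltr_pdivrMr// ler_pdivlMr//.
    by rewrite !(mulrC y).
  by rewrite !(mulrC y).
rewrite !lebesgue_measure_itv/= !lte_fin ltr_pM2r ?invr_gt0//.
case: ifPn => _; last by rewrite mule0.
by rewrite -EFinB -EFinM -mulrBl mulrCA mulfV ?mulr1// gt_eqF.
Qed.

(** Lebesgue measure is a multiple of its image under a dilation, so that the
    substitution z = x w needs no regularity of f. *)
Lemma ge0_integral_scale (x : R) (D : set R) (f : R -> \bar R) : (0 < x)%R ->
  measurable D -> measurable_fun D f -> (forall z, D z -> 0 <= f z) ->
  \int[leb]_(z in D) f z = x%:E * \int[leb]_(w in *%R x @^-1` D) f (x * w)%R.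
Proof.
move=> x0 mD mf f0.
pose fx : measurableTypeR R -> measurableTypeR R := *%R x.
pose m : {measure set (measurableTypeR R) -> \bar R} :=
  mscale (NngNum (ltW x0)) (pushforward leb fx).
rewrite (@eq_measure_integral _ (measurableTypeR R) _ D (m (mscal x))); last first.
  by move=> A mA _; exact: lebesgue_measure_scale.
rewrite ge0_integral_mscale//=; congr (_ * _).
rewrite (@ge0_integral_pushforward _ _ _ _ _ fx (mscal x))//.
by move=> z /[!inE]; exact: f0.
Qed.

End scaling.

Lemma integral_powR_tail (R : realType) (a s : R) : 0 < a -> 0 < s ->
  (\int[lebesgue_measure]_(w in `[a, +oo[) (w `^ (- s - 1))%:E = (a `^ (- s) / s)%:E)%E.
Proof.
move=> a0 s0; pose F (w : R) := - (w `^ (- s) / s).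
have dF (w : R) : 0 < w -> is_derive w 1 F (w `^ (- s - 1)).
  move=> w0; have -> : F = (fun w => - s^-1 * w `^ (- s)).
    by apply/funext => y; rewrite /F mulrC mulNr.
  have -> : w `^ (- s - 1) = - s^-1 * (- s * w `^ (- s - 1)).
    by rewrite mulrA mulrNN mulVf ?mul1r// gt_eqF.
  by apply: is_deriveZ; exact: is_derive1_powR.
rewrite (@ge0_continuous_FTC2y _ _ F a 0).
- by rewrite sub0e /F EFinN oppeK.
- by move=> x _; exact: powR_ge0.
- apply: derivable_within_continuous => x; rewrite in_itv/= andbT => ax.
  by have [] := is_derive1_powR (- s - 1) (lt_le_trans a0 ax).
- rewrite -oppr0; apply: cvgN; rewrite -(mul0r s^-1); apply: cvgMl.
  apply/cvgr0Pnorm_le => e e0; near=> w.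
  have w0 : 0 < w by near: w; exact: nbhs_pinfty_gt.
  rewrite ger0_norm ?powR_ge0//.
  have : e `^ (- s^-1) <= w by near: w; exact: nbhs_pinfty_ge.
  move=> /(ge0_ler_powR (ltW s0)); rewrite !nnegrE powR_ge0 (ltW w0) => /(_ isT isT).
  rewrite -powRrM mulNr mulVf ?gt_eqF// powR_inv1 ?(ltW e0)// => ew.
  by rewrite powRN invf_ple ?posrE ?powR_gt0.
- by move=> x ax; have [] := dF x (lt_trans a0 ax).
- apply: cvg_at_right_filter; apply: differentiable_continuous.
  by apply/derivable1_diffP; have [] := dF a a0.
- move=> x; rewrite in_itv/= andbT => ax.
  by rewrite derive1E (@derive_val _ _ _ _ _ _ _ (dF x (lt_trans a0 ax))).
Unshelve. all: by end_near. Qed.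

(** * The gain term and the moment of order minus mu *)

Lemma powRDp (R : realType) (x r s : R) : 0 < x -> x `^ (r + s) = x `^ r * x `^ s.
Proof. by move=> x0; rewrite powRD// (gt_eqF x0) implybT. Qed.

Section gain.
Context (R : realType) (p : {finite_measure set (measurableTypeR R) -> \bar R}).
Variable h : R -> R.
Local Notation leb := (@lebesgue_measure R).

(** With h = B g, the rate at which particles of each size break up, this is the gain
    term of the fragmentation operator at g. *)
Definition total_gain (x : R) : \bar R :=
  (\int[p]_(z in `[0%R, 1%R]) (h (x / z) / z)%:E)%E.

(** The integrand of the moment of h of order - mu in the variable w = 1 / y: with
    this variable, the substitution that extracts the moment from the gain is the
    dilation z = x w. *)
Definition moment_kernel (mu w : R) : R := h w^-1 * w `^ (mu - 2).

Definition truncated_moment (mu W : R) : \bar R :=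
  (\int[leb]_(w in `]0%R, W[) (moment_kernel mu w)%:E)%E.

Hypotheses (mh : measurable_fun setT h) (h0 : forall y, 0 <= h y).

Lemma measurable_fun_inv_ge0 : measurable_fun (`[0, +oo[ : set R) (@GRing.inv R).
Proof.
apply: (eq_measurable_fun (fun z : R => z `^ (-1))).
  move=> z; rewrite inE/= in_itv/= andbT => z0; by rewrite powR_inv1.
by apply: measurable_funTS; exact: measurable_powR.
Qed.

Lemma measurable_fun_gain (x : R) (D : set R) : measurable D -> D `<=` `[0, +oo[ ->
  measurable_fun D (fun z => h (x / z) / z).
Proof.
move=> mD D0; apply: (measurable_funS _ D0); first exact: measurable_itv.
apply: measurable_funM; last exact: measurable_fun_inv_ge0.
apply: measurableT_comp => //; apply: measurable_funM => //.
exact: measurable_fun_inv_ge0.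
Qed.

Lemma measurable_fun_moment_kernel (mu : R) (D : set R) :
  measurable D -> D `<=` `[0, +oo[ -> measurable_fun D (moment_kernel mu).
Proof.
move=> mD D0; apply: (measurable_funS _ D0); first exact: measurable_itv.
apply: measurable_funM; last by apply: measurable_funTS; exact: measurable_powR.
by apply: measurableT_comp => //; exact: measurable_fun_inv_ge0.
Qed.

Lemma moment_kernel_ge0 (mu w : R) : 0 <= moment_kernel mu w.
Proof. by rewrite mulr_ge0// powR_ge0. Qed.

(** If the fragment density were exactly z^(mu - 1) below e and zero above, the gain
    would be x^(mu - 1) times the moment of h over the sizes larger than x / e. *)
Lemma gain_scaling (mu x e : R) : 0 < x ->
  (\int[leb]_(z in `]0%R, e[) (h (x / z) / z * z `^ (mu - 1))%:E =
   (x `^ (mu - 1))%:E * truncated_moment mu (e / x))%E.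
Proof.
move=> x0.
have sub0 (c : R) : `]0, c[ `<=` (`[0, +oo[ : set R).
  by move=> z /=; rewrite !in_itv/= andbT => /andP[/ltW].
have mf : measurable_fun (`]0, e[ : set R) (fun z => (h (x / z) / z * z `^ (mu - 1))%:E).
  apply/measurable_EFinP; apply: measurable_funM.
    by apply: measurable_fun_gain; [exact: measurable_itv|exact: sub0].
  by apply: measurable_funTS; exact: measurable_powR.
have f0 z : `]0, e[%classic z -> (0 <= (h (x / z) / z * z `^ (mu - 1))%:E)%E.
  rewrite /= in_itv/= => /andP[z0 _].
  by rewrite lee_fin mulr_ge0 ?powR_ge0// divr_ge0// ltW.
rewrite (ge0_integral_scale x0 (measurable_itv _) mf f0).
have -> : *%R x @^-1` [set` `]0, e[] = [set` `]0, e / x[].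
  by apply/seteqP; split => w /=; rewrite !in_itv/= ltr_pdivlMr// (mulrC w) pmulr_rgt0.
transitivity (x%:E * \int[leb]_(w in `]0%R, (e / x)%R[)
    ((x `^ (mu - 2))%:E * (moment_kernel mu w)%:E))%E.
  congr (_ * _)%E; apply: eq_integral => w; rewrite inE/= in_itv/= => /andP[w0 _].
  rewrite -EFinM; congr EFin; rewrite /moment_kernel.
  have -> : x / (x * w) = w^-1 by rewrite invfM mulrA mulfV ?mul1r// gt_eqF.
  rewrite powRM ?(ltW x0) ?(ltW w0)//.
  have pw (y : R) : 0 < y -> y `^ (mu - 1) = y * y `^ (mu - 2).
    by move=> y0; rewrite -[X in X * _](powRr1 (ltW y0)) -powRDp//; congr powR; ring.
  by rewrite !pw//; field; rewrite !gt_eqF.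
rewrite ge0_integralZl//.
- rewrite muleA -EFinM; congr (_%:E * _)%E.
  by rewrite -[X in X * _](powRr1 (ltW x0)) -powRDp//; congr powR; ring.
- apply/measurable_EFinP; apply: measurable_fun_moment_kernel; last exact: sub0.
  exact: measurable_itv.
- by move=> w _; rewrite lee_fin moment_kernel_ge0.
- by rewrite lee_fin powR_ge0.
Qed.

Lemma le_truncated_moment (mu a b : R) : a <= b ->
  (truncated_moment mu a <= truncated_moment mu b)%E.
Proof.
move=> ab; apply: ge0_subset_integral => //=.
- apply/measurable_EFinP; apply: measurable_fun_moment_kernel.
    exact: measurable_itv.
  by move=> z /=; rewrite !in_itv/= andbT => /andP[/ltW].
- by move=> w _; rewrite lee_fin moment_kernel_ge0.
- by move=> z /=; rewrite !in_itv/= => /andP[-> /= /lt_le_trans ->].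
Qed.

Lemma truncated_moment_ge0 (mu a : R) : (0 <= truncated_moment mu a)%E.
Proof. by apply: integral_ge0 => w _; rewrite lee_fin moment_kernel_ge0. Qed.

Lemma integral_le_tail (mu a s M : R) (D : set R) : 0 < a -> 0 < s -> 0 <= M ->
  measurable D -> D `<=` `]0, +oo[ ->
  (forall w, D w -> a <= w -> moment_kernel mu w <= M * w `^ (- s - 1)) ->
  (\int[leb]_(w in D) (moment_kernel mu w)%:E <=
    truncated_moment mu a + (M * (a `^ (- s) / s))%:E)%E.
Proof.
move=> a0 s0 M0 mD D0 H.
have D0' : D `<=` `[0, +oo[.
  by move=> z /D0 /=; rewrite !in_itv/= !andbT => /ltW.
have mk : measurable_fun D (fun w => (moment_kernel mu w)%:E).
  by apply/measurable_EFinP; apply: measurable_fun_moment_kernel.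
have k0 w : (0 <= (moment_kernel mu w)%:E)%E by rewrite lee_fin moment_kernel_ge0.
have ma : measurable ([set` `[a, +oo[] : set R) by exact: measurable_itv.
have mb : measurable ([set` `]0, a[] : set R) by exact: measurable_itv.
have mDa : measurable (D `&` [set` `[a, +oo[]) by exact: measurableI.
have mDb : measurable (D `&` [set` `]0, a[]) by exact: measurableI.
have DE : D = (D `&` [set` `]0, a[]) `|` (D `&` [set` `[a, +oo[]).
  apply/seteqP; split => [w Dw|w [[]|[]]//].
  have := D0 _ Dw; rewrite /= in_itv/= andbT => w0.
  by have [wa|aw] := ltP w a; [left|right]; split => //=; rewrite in_itv/= ?w0 ?andbT.
rewrite [X in (\int[leb]_(w in X) _)%E]DE ge0_integral_setU//; last 2 first.
- by rewrite -DE.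
- apply/disj_setPS => w [[_ +] [_]] /=.
  by rewrite !in_itv/= andbT => /andP[_ wa] /(lt_le_trans wa); rewrite ltxx.
apply: leeD.
  apply: ge0_subset_integral => //=.
  apply/measurable_EFinP; apply: measurable_fun_moment_kernel => //.
  by move=> z /=; rewrite !in_itv/= andbT => /andP[/ltW].
rewrite EFinM -integral_powR_tail// -ge0_integralZl//; last 2 first.
- by apply/measurable_EFinP; apply: measurable_funTS; exact: measurable_powR.
- by move=> w _; rewrite lee_fin powR_ge0.
apply: (@le_trans _ _ (\int[leb]_(w in D `&` [set` `[a, +oo[]) (M%:E * (w `^ (- s - 1))%:E))%E).
  apply: ge0_le_integral => //.
  - by apply: measurable_funS mk => // w [].
  - apply/measurable_EFinP; apply: measurable_funM => //.
    by apply: measurable_funTS; exact: measurable_powR.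
  - by move=> w [Dw /=]; rewrite in_itv/= andbT => aw; rewrite -EFinM lee_fin H.
apply: ge0_subset_integral => //.
- apply/measurable_EFinP; apply: measurable_funM => //.
  by apply: measurable_funTS; exact: measurable_powR.
- by move=> w _; rewrite -EFinM lee_fin mulr_ge0// powR_ge0.
Qed.

Section near0.
Variables (e : R) (q : R -> R).
Hypotheses (mq : measurable_fun (`[0, e[ : set R) q)
  (q0 : forall z, 0 <= z < e -> 0 <= q z)
  (pq : forall A : set R, measurable A -> A `<=` `[0, e[ ->
          p A = (\int[leb]_(z in A) (q z)%:E)%E).

(** A measure that has a density near 0 has no atom there, so the endpoint can be
    dropped. *)
Lemma gain_near_part (x d : R) : 0 < d -> d <= e ->
  (\int[p]_(z in `[0%R, d[) (h (x / z) / z)%:E =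
   \int[leb]_(z in `]0%R, d[) (h (x / z) / z * q z)%:E)%E.
Proof.
move=> d0 de.
have sub : `[0, d[ `<=` (`[0, e[ : set R).
  by move=> z /=; rewrite !in_itv/= => /andP[-> /= /lt_le_trans ->].
have sub0 : `[0, d[ `<=` (`[0, +oo[ : set R).
  by move=> z /=; rewrite !in_itv/= andbT => /andP[].
have md : measurable ([set` `[0, d[] : set R) by exact: measurable_itv.
have mqd : measurable_fun (`[0, d[ : set R) q.
  exact: (measurable_funS (measurable_itv _) sub mq).
rewrite (@ge0_integral_density _ _ _ leb p _ q md)//; last 4 first.
- by move=> z zd; apply: q0; have /= := sub z zd; rewrite in_itv.
- by move=> A mA Ad; apply: pq => //; exact: (subset_trans Ad sub).
- by apply/measurable_EFinP; exact: measurable_fun_gain.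
- move=> z /=; rewrite in_itv/= => /andP[z0 _].
  by rewrite lee_fin divr_ge0.
rewrite -integral_itv_obnd_cbnd//.
apply: emeasurable_funM.
  apply/measurable_EFinP; apply: measurable_fun_gain; first exact: measurable_itv.
  by move=> z /=; rewrite !in_itv/= andbT => /andP[/ltW].
apply/measurable_EFinP; apply: measurable_funS mqd => // z /=.
by rewrite !in_itv/= => /andP[/ltW ->].
Qed.
End near0.
End gain.

(** * Bounds on the gain *)

Lemma ae_exists_itv (R : realType) (P : R -> Prop) (b : R) : 0 < b ->
  {ae lebesgue_measure, forall x : R, P x} -> exists2 x, 0 < x < b & P x.
Proof.
move=> b0 [N [mN N0 PN]]; apply: contrapT => H.
suff : (lebesgue_measure (`]0%R, b[%classic : set R) <= lebesgue_measure N)%E.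
  rewrite [X in (_ <= X)%E]N0 lebesgue_measure_itv/= lte_fin b0 sube0.
  by rewrite lee_fin leNgt b0.
apply: le_measure; rewrite ?inE//.
move=> x /=; rewrite in_itv/= => xb; apply: PN => /= Px; apply: H.
by exists x.
Qed.

Section gain_bounds.
Context (R : realType) (p : {finite_measure set (measurableTypeR R) -> \bar R}).
Variable h : R -> R.
Hypotheses (mh : measurable_fun setT h) (h0 : forall y, 0 <= h y).
Variables (e : R) (q : R -> R).
Hypotheses (mq : measurable_fun (`[0, e[ : set R) q)
  (q0 : forall z, 0 <= z < e -> 0 <= q z)
  (pq : forall A : set R, measurable A -> A `<=` `[0, e[ ->
          p A = (\int[lebesgue_measure]_(z in A) (q z)%:E)%E).
Local Notation leb := (@lebesgue_measure R).
Local Notation gain := (total_gain p h).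
Local Notation K := (truncated_moment h).

Let mg (x : R) (D : set R) : measurable D -> D `<=` `[0, +oo[ ->
  measurable_fun D (fun z => (h (x / z) / z)%:E).
Proof. by move=> mD D0; apply/measurable_EFinP; exact: measurable_fun_gain. Qed.

Let g0 (x z : R) : 0 <= z -> 0 <= h (x / z) / z.
Proof. by move=> z0; rewrite divr_ge0. Qed.

Lemma gain_ge (c mu d x : R) : 0 < d -> d <= e -> d <= 1 -> 0 <= c -> 0 < x ->
  (forall z, 0 < z < d -> c * z `^ (mu - 1) <= q z) ->
  ((c * x `^ (mu - 1))%:E * K mu (d / x) <= gain x)%E.
Proof.
move=> d0 de d1 c0 x0 cq.
have s1 : `[0, 1] `<=` (`[0, +oo[ : set R).
  by move=> z /=; rewrite !in_itv/= andbT => /andP[].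
have s2 : `]0, d[ `<=` (`[0, +oo[ : set R).
  by move=> z /=; rewrite !in_itv/= andbT => /andP[/ltW].
have m2 : measurable ([set` `]0, d[] : set R) by exact: measurable_itv.
apply: (@le_trans _ _ (\int[p]_(z in `[0%R, d[) (h (x / z) / z)%:E)%E); last first.
  apply: ge0_subset_integral => //; first exact: mg.
    by move=> z /=; rewrite in_itv/= => /andP[z0 _]; rewrite lee_fin g0.
  by move=> z /=; rewrite !in_itv/= => /andP[-> /= /ltW /le_trans ->].
rewrite (gain_near_part mh h0 mq q0 pq)// EFinM -muleA -gain_scaling//.
rewrite -ge0_integralZl//; last 2 first.
- apply/measurable_EFinP; apply: measurable_funM; first exact: measurable_fun_gain.
  by apply: measurable_funTS; exact: measurable_powR.
- move=> z /=; rewrite in_itv/= => /andP[z0 _].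
  by rewrite lee_fin mulr_ge0 ?powR_ge0// g0 ?ltW.
apply: ge0_le_integral => //.
- move=> z /=; rewrite in_itv/= => /andP[z0 _].
  by rewrite -EFinM lee_fin !mulr_ge0 ?powR_ge0// ?invr_ge0 ltW.
- apply/measurable_EFinP; apply: measurable_funM => //.
  apply: measurable_funM; first exact: measurable_fun_gain.
  by apply: measurable_funTS; exact: measurable_powR.
- apply/measurable_EFinP; apply: measurable_funM; first exact: measurable_fun_gain.
  apply: (measurable_funS (measurable_itv _) _ mq) => z /=.
  by rewrite !in_itv/= => /andP[/ltW -> /= /lt_le_trans ->].
- move=> z /=; rewrite in_itv/= => /andP[z0 zd].
  rewrite -EFinM lee_fin mulrCA ler_wpM2l ?g0 ?(ltW z0)// cq// z0//.
Qed.

Lemma gain_le (c mu d x M : R) : 0 < d -> d <= e -> d <= 1 -> 0 <= c -> 0 < x ->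
  (forall z, 0 < z < d -> q z <= c * z `^ (mu - 1)) ->
  (forall z, d <= z <= 1 -> h (x / z) / z <= M) ->
  (gain x <= (c * x `^ (mu - 1))%:E * K mu (d / x)
             + (M * fine (p `[0%R, 1%R]%classic))%:E)%E.
Proof.
move=> d0 de d1 c0 x0 cq hM.
have s1 : `[0, 1] `<=` (`[0, +oo[ : set R).
  by move=> z /=; rewrite !in_itv/= andbT => /andP[].
have s2 : `]0, d[ `<=` (`[0, +oo[ : set R).
  by move=> z /=; rewrite !in_itv/= andbT => /andP[/ltW].
have s3 : `[d, 1] `<=` (`[0, +oo[ : set R).
  by move=> z /=; rewrite !in_itv/= andbT => /andP[/(le_trans (ltW d0))].
have m2 : measurable ([set` `]0, d[] : set R) by exact: measurable_itv.
have m3 : measurable ([set` `[d, 1]] : set R) by exact: measurable_itv.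
have M0 : 0 <= M.
  by apply: (le_trans (g0 x ler01)); apply: hM; rewrite d1 lexx.
have E : `[0, 1]%classic = `[0, d[ `|` `[d, 1] :> set R.
  apply/seteqP; split => z /=; rewrite !in_itv/=.
    by move=> /andP[-> ->]; have [?|?] := ltP z d; [left|right].
  move=> [] /andP[]; first by move=> -> /ltW /le_trans ->.
  by move=> /(le_trans (ltW d0)) -> ->.
rewrite /total_gain E ge0_integral_setU//; last 3 first.
- by rewrite -E; exact: mg.
- by rewrite -E => z /=; rewrite in_itv/= => /andP[z0 _]; rewrite lee_fin g0.
- apply/disj_setPS => w [] /=.
  by rewrite !in_itv/= => /andP[_ wd] /andP[/(lt_le_trans wd)]; rewrite ltxx.
rewrite -E; apply: leeD.
  rewrite (gain_near_part mh h0 mq q0 pq)// EFinM -muleA -gain_scaling//.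
  rewrite -ge0_integralZl//; last 2 first.
  - apply/measurable_EFinP; apply: measurable_funM; first exact: measurable_fun_gain.
    by apply: measurable_funTS; exact: measurable_powR.
  - move=> z /=; rewrite in_itv/= => /andP[z0 _].
    by rewrite lee_fin mulr_ge0 ?powR_ge0// g0 ?ltW.
  apply: ge0_le_integral => //.
  - move=> z /=; rewrite in_itv/= => /andP[z0 zd].
    rewrite lee_fin mulr_ge0 ?g0 ?(ltW z0)// q0// (ltW z0)/=.
    exact: lt_le_trans de.
  - apply/measurable_EFinP; apply: measurable_funM; first exact: measurable_fun_gain.
    apply: (measurable_funS (measurable_itv _) _ mq) => z /=.
    by rewrite !in_itv/= => /andP[/ltW -> /= /lt_le_trans ->].
  - apply/measurable_EFinP; apply: measurable_funM => //.
    apply: measurable_funM; first exact: measurable_fun_gain.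
    by apply: measurable_funTS; exact: measurable_powR.
  - move=> z /=; rewrite in_itv/= => /andP[z0 zd].
    by rewrite -EFinM lee_fin mulrCA ler_wpM2l ?g0 ?(ltW z0)// cq// z0.
apply: (@le_trans _ _ (\int[p]_(z in `[d, 1%R]) M%:E)%E).
  apply: ge0_le_integral => //.
  - move=> z /=; rewrite in_itv/= => /andP[dz _].
    by rewrite lee_fin g0// (le_trans (ltW d0)).
  - exact: mg.
rewrite integral_cst// EFinM fineK; last exact: fin_num_measure.
apply: lee_wpmul2l; rewrite ?lee_fin//.
by apply: le_measure; rewrite ?inE//; rewrite E; exact: subsetUr.
Qed.

(** The equation makes the gain finite at almost every x, and a finite gain at x
    bounds the moment of h over the sizes larger than x / d, which exhaust the
    half-line when x tends to 0. *)
Lemma truncated_moment_lty (c mu d : R) : 0 < d -> d <= e -> d <= 1 -> 0 < c ->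
  (forall z, 0 < z < d -> c * z `^ (mu - 1) <= q z) ->
  {ae leb, forall x : R, 0 < x -> (gain x < +oo)%E} ->
  forall W, 0 < W -> (K mu W < +oo)%E.
Proof.
move=> d0 de d1 c0 cq fin W W0.
have [x /andP[x0 xd] gx] := ae_exists_itv (divr_gt0 d0 W0) fin.
apply: (@le_lt_trans _ _ (K mu (d / x))).
  apply: le_truncated_moment => //.
  by rewrite ler_pdivlMr// mulrC -ler_pdivlMr// ltW.
have A : 0 < c * x `^ (mu - 1) by rewrite mulr_gt0// powR_gt0.
have := le_lt_trans (gain_ge d0 de d1 (ltW c0) x0 cq) (gx x0).
rewrite lt_neqAle leey andbT => /eqP H; rewrite lt_neqAle leey andbT.
by apply/eqP => Ky; apply: H; rewrite Ky gt0_muley// lte_fin.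
Qed.

(** The fragments z in [d, 1] come from sizes x / z comparable with x, where a power
    bound on h is the same bound at x up to a constant. *)
Lemma gain_mid_le (b S a dl mu d x z : R) : 0 < d -> 0 < x -> 0 <= b -> 0 <= S ->
  0 <= a -> 0 <= dl -> 0 <= mu -> d <= z <= 1 ->
  (forall y, x <= y <= x / d -> h y <= b * y `^ (dl - 1) * (S * (y `^ mu + a))) ->
  h (x / z) / z <= b * S * d `^ (- dl - mu) * x `^ (dl - 1) * (x `^ mu + a).
Proof.
move=> d0 x0 b0 S0 a0 dl0 mu0 /andP[dz z1] hy.
have z0 : 0 < z by exact: lt_le_trans dz.
have y0 : 0 < x / z by rewrite divr_gt0.
have zd : z^-1 <= d^-1 by rewrite lef_pV2 ?posrE.
have yd : x / z <= x / d by rewrite ler_pM2l.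
have xy : x <= x / z by rewrite ler_pdivlMr// ler_piMr// ltW.
have := hy (x / z); rewrite xy yd => /(_ isT) H.
apply: le_trans (ler_wpM2r _ H) _; first by rewrite invr_ge0 ltW.
have -> : b * (x / z) `^ (dl - 1) * (S * ((x / z) `^ mu + a)) / z =
    b * S * ((x / z) `^ dl * (x^-1)) * ((x / z) `^ mu + a).
  rewrite powRDp// powR_inv1 ?(ltW y0)//; field.
  by rewrite !gt_eqF.
have E : x `^ (dl - 1) = x `^ dl * x^-1 by rewrite powRDp// powR_inv1// ltW.
have d1 : d <= 1 by exact: le_trans z1.
have P (s : R) : 0 <= s -> (x / z) `^ s <= d `^ (- s) * x `^ s.
  move=> s0; apply: (@le_trans _ _ ((x / d) `^ s)).
    by apply: ge0_ler_powR; rewrite ?nnegrE// ltW// divr_gt0.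
  rewrite powRM ?(ltW x0) ?invr_ge0 ?(ltW d0)//.
  by rewrite -powR_inv1 ?(ltW d0)// -powRrM mulN1r mulrC.
have D (s : R) : 0 <= s -> 1 <= d `^ (- s).
  move=> s0; rewrite powRN invf_ge1 ?powR_gt0//.
  rewrite -(powRr0 d); apply: ger_powR => //; by rewrite d0 d1.
rewrite (powRDp (- dl) (- mu) d0) E.
have -> : b * S * (d `^ (- dl) * d `^ (- mu)) * (x `^ dl / x) * (x `^ mu + a) =
  b * S * (d `^ (- dl) * x `^ dl / x) * (d `^ (- mu) * (x `^ mu + a)) by ring.
apply: ler_pM.
- by rewrite !mulr_ge0 ?powR_ge0// invr_ge0 ltW.
- by rewrite addr_ge0// powR_ge0.
- by rewrite ler_wpM2l ?mulr_ge0// ler_wpM2r ?P// invr_ge0 ltW.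
- by rewrite mulrDr lerD ?P// ler_peMl// D.
Qed.

End gain_bounds.

(** * The a priori bound on the profile *)

Section apriori.
Context (R : realType) (p : {finite_measure set (measurableTypeR R) -> \bar R}).
Variable h : R -> R.
Hypotheses (mh : measurable_fun setT h) (h0 : forall y, 0 <= h y).
Variables (e : R) (q : R -> R).
Hypotheses (mq : measurable_fun (`[0, e[ : set R) q)
  (q0 : forall z, 0 <= z < e -> 0 <= q z)
  (pq : forall A : set R, measurable A -> A `<=` `[0, e[ ->
          p A = (\int[lebesgue_measure]_(z in A) (q z)%:E)%E).
Local Notation leb := (@lebesgue_measure R).
Local Notation gain := (total_gain p h).
Local Notation K := (truncated_moment h).
Local Notation P0 := (fine (p `[0%R, 1%R]%classic)).

Variables (mu eta b r1 d c1 c2 : R) (F : R -> R).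
Hypotheses (eta0 : 0 < eta) (eta_mu : eta <= mu) (b0 : 0 <= b) (r10 : 0 < r1).
Hypotheses (acF : locally_abs_continuous F) (F0 : F x @[x --> 0^'+] --> (0 : R))
  (Fge0 : forall x, 0 < x -> 0 <= F x).
Hypothesis hF :
  forall y, 0 < y <= r1 -> h y <= b * y `^ (eta + eta - 1) * F y.
Hypotheses (d0 : 0 < d) (de : d <= e) (d1 : d <= 1) (c10 : 0 < c1) (c20 : 0 <= c2)
  (c1q : forall z, 0 < z < d -> c1 * z `^ (mu - 1) <= q z)
  (c2q : forall z, 0 < z < d -> q z <= c2 * z `^ (mu - 1)).
Hypothesis Feq : {ae leb, forall x : R, 0 < x ->
  [/\ derivable F x 1, (gain x < +oo)%E & ((derive1 F x)%:E <= gain x)%E]}.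

Let mu0 : 0 < mu. Proof. exact: lt_le_trans eta_mu. Qed.

Let P00 : 0 <= P0. Proof. by rewrite fine_ge0. Qed.

(** The part c2 b / eta comes from the fragments below d, the other part from those
    above d; the constant does not depend on r, S and a below. *)
Let C : R := c2 * b / eta + b * d `^ (- (eta + eta) - mu) * P0.

Let C0 : 0 <= C.
Proof. by rewrite addr_ge0// ?mulr_ge0 ?powR_ge0// invr_ge0 ltW. Qed.

Lemma truncated_moment_fin W : 0 < W -> K mu W \is a fin_num.
Proof.
move=> W0; rewrite ge0_fin_numE ?truncated_moment_ge0//.
apply: (truncated_moment_lty mh h0 mq q0 pq d0 de d1 c10 c1q) => //.
by apply: ae_imply Feq => x H /H[].
Qed.

(** Half of the exponent eta + eta is spent on integrability at infinity; the other
    half keeps the weight a in front of a power of W smaller than mu. *)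
Lemma moment_kernel_le r S a w W : 0 < r -> r <= r1 -> r <= 1 -> 0 <= S -> 0 <= a ->
  (forall y, 0 < y <= r -> F y <= S * (y `^ mu + a)) ->
  r^-1 <= w -> w <= W ->
  moment_kernel h mu w <= b * S * (1 + a * W `^ (mu - eta)) * w `^ (- eta - 1).
Proof.
move=> r0 rr1 r_1 S0 a0 FS rw wW.
have r'1 : 1 <= r^-1 by rewrite invf_ge1.
have w1 : 1 <= w by exact: le_trans rw.
have w0 : 0 < w by exact: lt_le_trans w1.
have y0 : 0 < w^-1 by rewrite invr_gt0.
have yr : w^-1 <= r by rewrite invf_ple ?posrE.
have yr1 : w^-1 <= r1 by exact: le_trans rr1.
have H : h w^-1 <= b * w^-1 `^ (eta + eta - 1) * (S * (w^-1 `^ mu + a)).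
  apply: le_trans (hF _) _; first by rewrite y0.
  by rewrite ler_wpM2l ?mulr_ge0 ?powR_ge0// FS// y0.
have inv s : w^-1 `^ s = w `^ (- s).
  by rewrite -powR_inv1 ?(ltW w0)// -powRrM mulN1r.
rewrite /moment_kernel; apply: le_trans (ler_wpM2r (powR_ge0 _ _) H) _.
rewrite !inv.
have -> : b * w `^ (- (eta + eta - 1)) * (S * (w `^ (- mu) + a)) * w `^ (mu - 2) =
    b * S * (w `^ (- (eta + eta) - 1) + a * w `^ (mu - eta) * w `^ (- eta - 1)).
  have -> : b * w `^ (- (eta + eta - 1)) * (S * (w `^ (- mu) + a)) * w `^ (mu - 2) =
    b * S * (w `^ (- (eta + eta - 1)) * w `^ (- mu) * w `^ (mu - 2) +
       a * (w `^ (- (eta + eta - 1)) * w `^ (mu - 2))) by ring.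
  rewrite -!powRDp// -[a * w `^ (mu - eta) * _]mulrA -powRDp//.
  by congr (_ * (_ `^ _ + _ * _ `^ _)); ring.
rewrite -[leRHS]mulrA ler_wpM2l ?mulr_ge0// mulrDl mul1r lerD//.
  by apply: ler_powR => //; rewrite lerB// lerN2 lerDl ltW.
rewrite ler_wpM2r ?powR_ge0// ler_wpM2l// ge0_ler_powR ?subr_ge0// nnegrE ltW//.
exact: lt_le_trans wW.
Qed.

(** The factor r^eta makes the terms that depend on S small. The weight a appears
    with x^(eta - 1), which is integrable at 0. *)
Lemma gain_le_weight r S a x : 0 < r -> r <= r1 -> r <= 1 -> 0 <= S -> 0 <= a ->
  (forall y, 0 < y <= r -> F y <= S * (y `^ mu + a)) ->
  0 < x -> x <= d * r ->
  (gain x <= ((c2 * fine (K mu r^-1) + S * C * r `^ eta) * x `^ (mu - 1)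
    + S * C * r `^ eta * a * x `^ (eta - 1))%:E)%E.
Proof.
move=> r0 rr1 r_1 S0 a0 FS x0 xdr.
have xr : x <= r by apply: le_trans xdr _; rewrite ler_piMl// ltW.
have xd : x / d <= r by rewrite ler_pdivrMr// mulrC.
have x'0 : 0 < x^-1 by rewrite invr_gt0.
pose M := b * S * (1 + a * x^-1 `^ (mu - eta)).
have M0 : 0 <= M by rewrite !mulr_ge0// addr_ge0// mulr_ge0// powR_ge0.
have Kx : (K mu (d / x) <= K mu r^-1 + (M * (r^-1 `^ (- eta) / eta))%:E)%E.
  apply: integral_le_tail => //.
  - by rewrite invr_gt0.
  - by move=> w /=; rewrite !in_itv/= andbT => /andP[].
  - move=> w /=; rewrite in_itv/= => /andP[w0 wd] rw.
    apply: (@moment_kernel_le r) => //.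
    by rewrite (le_trans (ltW wd))// ler_piMl// ltW.
have Hm z : d <= z <= 1 -> h (x / z) / z <=
    b * S * d `^ (- (eta + eta) - mu) * x `^ (eta + eta - 1) * (x `^ mu + a).
  move=> dz; apply: gain_mid_le => //; [by rewrite addr_ge0// ltW|exact: ltW|].
  move=> y /andP[xy yxd]; have y0 : 0 < y by exact: lt_le_trans xy.
  have yr : y <= r by exact: le_trans xd.
  apply: le_trans (hF _) _; first by rewrite y0 (le_trans yr).
  by rewrite ler_wpM2l ?mulr_ge0 ?powR_ge0// FS// y0.
apply: le_trans (gain_le mh h0 mq q0 pq d0 de d1 c20 x0 c2q Hm) _.
have cx : 0 <= c2 * x `^ (mu - 1) by rewrite mulr_ge0// powR_ge0.
apply: (@le_trans _ _ ((c2 * x `^ (mu - 1))%:E *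
    (K mu r^-1 + (M * (r^-1 `^ (- eta) / eta))%:E) + _)%E).
  by apply: leeD; [apply: lee_wpmul2l; rewrite ?lee_fin// |exact: lexx].
rewrite -[X in (_ * (X + _))%E]fineK; last first.
  by apply: truncated_moment_fin; rewrite invr_gt0.
rewrite -EFinD lee_fin.
set k := fine _.
have -> : r^-1 `^ (- eta) = r `^ eta.
  by rewrite -powR_inv1 ?(ltW r0)// -powRrM mulN1r opprK.
have xm : x `^ (mu - 1) * x^-1 `^ (mu - eta) = x `^ (eta - 1).
  rewrite -powR_inv1 ?(ltW x0)// -powRrM -powRDp//; congr powR; ring.
have e1 : x `^ (eta + eta - 1) = x `^ eta * x `^ (eta - 1).
  by rewrite -powRDp//; congr powR; ring.
have e2 : x `^ (eta + eta - 1) * x `^ mu = x `^ (eta + eta) * x `^ (mu - 1).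
  by rewrite -!powRDp//; congr powR; ring.
have xe : x `^ eta <= r `^ eta.
  by apply: ge0_ler_powR; rewrite ?nnegrE// ltW.
have xe2 : x `^ (eta + eta) <= r `^ eta.
  rewrite powRDp// -[leRHS]mulr1; apply: ler_pM; rewrite ?powR_ge0//.
  by rewrite -(powRr0 x); apply: ger_powR; rewrite ?(ltW eta0)// x0 (le_trans xr).
have A : x `^ (eta + eta - 1) * (x `^ mu + a) <=
    r `^ eta * (x `^ (mu - 1) + a * x `^ (eta - 1)).
  rewrite mulrDr e2 e1 mulrDr lerD//; first by rewrite ler_wpM2r ?powR_ge0.
  by rewrite -mulrA (mulrC _ a) ler_wpM2r// mulr_ge0 ?powR_ge0.
have B0 : 0 <= b * S * d `^ (- (eta + eta) - mu) by rewrite !mulr_ge0// powR_ge0.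
have := ler_wpM2r P00 (ler_wpM2l B0 A).
rewrite /M /C.
have -> : c2 * x `^ (mu - 1) *
   (k + b * S * (1 + a * x^-1 `^ (mu - eta)) * (r `^ eta / eta)) =
   c2 * k * x `^ (mu - 1) + c2 * b * S * (r `^ eta / eta) *
     (x `^ (mu - 1) + a * (x `^ (mu - 1) * x^-1 `^ (mu - eta))) by ring.
rewrite xm => H.
have -> : (c2 * k + S * (c2 * b / eta + b * d `^ (- (eta + eta) - mu) * P0) * r `^ eta) *
    x `^ (mu - 1) + S * (c2 * b / eta + b * d `^ (- (eta + eta) - mu) * P0) *
    r `^ eta * a * x `^ (eta - 1) =
   c2 * k * x `^ (mu - 1) + c2 * b * S * (r `^ eta / eta) *
     (x `^ (mu - 1) + a * x `^ (eta - 1)) +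
   b * S * d `^ (- (eta + eta) - mu) *
      (r `^ eta * (x `^ (mu - 1) + a * x `^ (eta - 1))) * P0 by ring.
by rewrite lerD2l -[X in X * P0 <= _]mulrA.
Qed.

(** Bootstrapping in one step: the best constant S in F <= S (x^mu + a) on (0, r],
    finite since F is bounded, satisfies S <= const + S / 2 with a constant that
    does not depend on a, once r is small. *)
Lemma profile_le_powR : exists S r, [/\ 0 <= S, 0 < r &
  forall x, 0 < x <= r -> F x <= S * x `^ mu].
Proof.
have [rF rF0 FrF] : exists2 r, 0 < r & forall x, 0 < x <= r -> F x <= 1.
  apply/near0P; move/cvgrPdist_le : F0 => /(_ 1 ltr01).
  by apply: filterS => x; rewrite sub0r normrN; apply: le_trans; exact: ler_norm.
pose c := C * (mu^-1 + eta^-1) + 1.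
have c_gt0 : 0 < c.
  by rewrite ltr_wpDl// mulr_ge0// addr_ge0// invr_ge0 ltW.
(* The last term makes the coefficient of S in the supersolution at most 1/2. *)
pose r := Num.min (Num.min rF r1) (Num.min 1 ((2 * c)^-1 `^ eta^-1)).
have r0 : 0 < r by rewrite !lt_min rF0 r10 ltr01 powR_gt0// invr_gt0 mulr_gt0.
have rrF : r <= rF by rewrite !ge_min lexx.
have rr1 : r <= r1 by rewrite !ge_min lexx orbT.
have r_1 : r <= 1 by rewrite !ge_min lexx !orbT.
have rc : C * r `^ eta * (mu^-1 + eta^-1) <= 2^-1.
  have : r `^ eta <= (2 * c)^-1.
    have : r <= (2 * c)^-1 `^ eta^-1 by rewrite !ge_min lexx !orbT.
    move=> /(ge0_ler_powR (ltW eta0)); rewrite !nnegrE powR_ge0 (ltW r0) => /(_ isT isT).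
    by rewrite -powRrM mulVf ?gt_eqF// powRr1// invr_ge0 mulr_ge0// ltW.
  move=> H; have cn : C * (mu^-1 + eta^-1) <= c by rewrite lerDl.
  apply: (@le_trans _ _ (c * r `^ eta)).
    by rewrite mulrAC ler_wpM2r// powR_ge0.
  apply: le_trans (ler_wpM2l (ltW c_gt0) H) _.
  by rewrite invfM mulrCA mulfV ?mulr1// gt_eqF.
pose k := fine (K mu r^-1).
have k0 : 0 <= k by rewrite fine_ge0// truncated_moment_ge0.
have dr0 : 0 < d * r by rewrite mulr_gt0.
pose S0 := 2 * (c2 * k / mu + (d * r) `^ (- mu)).
have S00 : 0 <= S0.
  by rewrite mulr_ge0// addr_ge0 ?powR_ge0// !mulr_ge0// invr_ge0 ltW.
suff FS x a : 0 < x <= r -> 0 < a -> F x <= S0 * (x `^ mu + a).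
  exists S0, r; split => // x xr; apply/ler_addgt0Pr => t t0.
  have S10 : 0 < S0 + 1 by rewrite ltr_wpDl.
  apply: le_trans (FS x (t / (S0 + 1)) xr _) _; first by rewrite divr_gt0.
  rewrite mulrDr lerD2l mulrCA ger_pMr// ler_pdivrMr// mul1r lerDl//.
move=> xr a0.
pose E := [set F y / (y `^ mu + a) | y in [set y | 0 < y <= r]].
have w0 y : 0 < y `^ mu + a by rewrite ltr_wpDl ?powR_ge0.
have ubE : has_ubound E.
  exists a^-1 => _ [y /= /andP[y0 yr] <-].
  rewrite ler_pdivrMr// mulrDr mulVf ?gt_eqF//.
  apply: (@le_trans _ _ 1); first by apply: FrF; rewrite y0 (le_trans yr).
  by rewrite lerDr mulr_ge0 ?powR_ge0// invr_ge0 ltW.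
pose S := sup E.
have FS y : 0 < y <= r -> F y <= S * (y `^ mu + a).
  by move=> yr; rewrite -ler_pdivrMr//; apply: ub_le_sup => //; exists y.
have S_ge0 : 0 <= S.
  have rr : 0 < r <= r by rewrite r0 lexx.
  apply: (@le_trans _ _ (F r / (r `^ mu + a))); first by rewrite divr_ge0 ?Fge0// ltW.
  by apply: ub_le_sup => //; exists r.
suff SS : S <= c2 * k / mu + (d * r) `^ (- mu) + S / 2.
  apply: le_trans (FS x xr) _; rewrite ler_wpM2r ?(ltW (w0 _))//.
  by rewrite /S0; lra.
apply: sup_le_ub; first by exists (F r / (r `^ mu + a)), r => //=; rewrite r0 lexx.
move=> _ [y /= /andP[y0 yr] <-]; rewrite ler_pdivrMr//.
(* Above d r, where the gain is not controlled by F on (0, r], F <= 1 suffices. *)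
have [ydr|dry] := leP y (d * r); last first.
  apply: (@le_trans _ _ ((d * r) `^ (- mu) * (y `^ mu + a))).
    apply: (@le_trans _ _ 1); first by apply: FrF; rewrite y0 (le_trans yr).
    rewrite powRN ler_pdivlMl ?powR_gt0// mulr1.
    apply: (@le_trans _ _ (y `^ mu)); last by rewrite lerDl ltW.
    by apply: ge0_ler_powR; rewrite ?nnegrE ltW.
  rewrite ler_wpM2r ?(ltW (w0 _))//.
  rewrite addrAC lerDr addr_ge0 ?divr_ge0// ?mulr_ge0// ltW//.
have Fle := @comparison_powR R (d * r) F ((c2 * k + S * C * r `^ eta) / mu) mu
   (S * C * r `^ eta * a / eta) eta mu0 eta0 acF F0.
apply: le_trans (Fle _ y _) _; last 2 first.
- by rewrite y0.
- have y1 : y `^ eta <= 1.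
    rewrite -(powRr0 y); apply: ger_powR; rewrite ?(ltW eta0)// y0.
    by rewrite (le_trans yr).
  have T0 : 0 <= S * C * r `^ eta by rewrite !mulr_ge0// powR_ge0.
  apply: (@le_trans _ _ ((c2 * k / mu + S * (C * r `^ eta * (mu^-1 + eta^-1))) *
    (y `^ mu + a))).
    have -> : (c2 * k / mu + S * (C * r `^ eta * (mu^-1 + eta^-1))) * (y `^ mu + a) =
      (c2 * k + S * C * r `^ eta) / mu * y `^ mu + S * C * r `^ eta * a / eta * 1 +
      (c2 * k / mu * a + S * C * r `^ eta / eta * y `^ mu + S * C * r `^ eta * a / mu).
      by ring.
    apply: ler_wpDr.
      by rewrite !addr_ge0// !mulr_ge0 ?invr_ge0 ?powR_ge0// ltW.
    rewrite lerD2l ler_wpM2l// !mulr_ge0 ?powR_ge0// ?invr_ge0 ltW//.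
  rewrite ler_wpM2r ?(ltW (w0 _))// lerD ?lerDl ?powR_ge0//.
  by rewrite ler_wpM2l.
apply: ae_imply Feq => z H /andP[z0 zdr] _; have [dF _ F'] := H z0.
split => //; rewrite -lee_fin; apply: le_trans F' _.
apply: le_trans (@gain_le_weight r S a z _ _ _ _ _ FS z0 _) _ => //; try exact: ltW.
rewrite lee_fin -/k le_eqVlt; apply/orP; left; apply/eqP.
by field; rewrite !gt_eqF.
Qed.

End apriori.

(** * An equivalent of the gain at 0 *)

Section gain_equivalent.
Context (R : realType) (p : {finite_measure set (measurableTypeR R) -> \bar R}).
Variable h : R -> R.
Hypotheses (mh : measurable_fun setT h) (h0 : forall y, 0 <= h y).
Variables (e : R) (q : R -> R).
Hypotheses (mq : measurable_fun (`[0, e[ : set R) q)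
  (q0 : forall z, 0 <= z < e -> 0 <= q z)
  (pq : forall A : set R, measurable A -> A `<=` `[0, e[ ->
          p A = (\int[lebesgue_measure]_(z in A) (q z)%:E)%E).
Local Notation leb := (@lebesgue_measure R).
Local Notation gain := (total_gain p h).
Local Notation K := (truncated_moment h).
Local Notation P0 := (fine (p `[0%R, 1%R]%classic)).

Variables (mu dl M r p0 : R).
Hypotheses (mu0 : 0 < mu) (dl0 : 0 < dl) (M0 : 0 <= M) (r0 : 0 < r) (p00 : 0 < p0).
Hypothesis hM : forall y, 0 < y <= r -> h y <= M * y `^ (dl - 1) * y `^ mu.
Hypothesis qp0 : forall t, 0 < t -> exists d, [/\ 0 < d, d <= e, d <= 1 &
  forall z, 0 < z < d -> `|q z - p0 * z `^ (mu - 1)| <= t * z `^ (mu - 1)].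
Hypothesis Kfin : forall W, 0 < W -> (K mu W < +oo)%E.

Definition total_moment (h : R -> R) (mu : R) : \bar R :=
  (\int[lebesgue_measure]_(w in `]0%R, +oo[) (moment_kernel h mu w)%:E)%E.

Let kernel_le w : r^-1 <= w -> moment_kernel h mu w <= M * w `^ (- dl - 1).
Proof.
move=> rw; have w0 : 0 < w by apply: lt_le_trans rw; rewrite invr_gt0.
have inv s : w^-1 `^ s = w `^ (- s).
  by rewrite -powR_inv1 ?(ltW w0)// -powRrM mulN1r.
have /hM H : 0 < w^-1 <= r by rewrite invr_gt0 w0 invf_ple ?posrE.
apply: le_trans (ler_wpM2r (powR_ge0 _ _) H) _.
rewrite !inv -!mulrA -!powRDp// le_eqVlt; apply/orP; left; apply/eqP.
by congr (_ * _ `^ _); ring.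
Qed.

Let total_moment_le W : r^-1 <= W ->
  (total_moment h mu <= K mu W + (M * (W `^ (- dl) / dl))%:E)%E.
Proof.
move=> rW; apply: integral_le_tail => //; first by apply: lt_le_trans rW; rewrite invr_gt0.
by move=> w _ Ww; apply: kernel_le; exact: le_trans Ww.
Qed.

Lemma total_moment_lty : (total_moment h mu < +oo)%E.
Proof.
apply: le_lt_trans (total_moment_le (lexx _)) _.
by rewrite lte_add_pinfty ?ltry// Kfin// invr_gt0.
Qed.

Lemma total_moment_ge0 : (0 <= total_moment h mu)%E.
Proof. by apply: integral_ge0 => w _; rewrite lee_fin moment_kernel_ge0. Qed.

Let I := fine (total_moment h mu).

Let IE : total_moment h mu = I%:E.
Proof. by rewrite fineK// ge0_fin_numE ?total_moment_ge0// total_moment_lty. Qed.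

Let I0 : 0 <= I. Proof. by rewrite fine_ge0// total_moment_ge0. Qed.

Let truncated_le W : (K mu W <= I%:E)%E.
Proof.
rewrite -IE; apply: ge0_subset_integral => //=.
- apply/measurable_EFinP; apply: measurable_fun_moment_kernel => //.
  by move=> z /=; rewrite !in_itv/= !andbT => /ltW.
- by move=> w _; rewrite lee_fin moment_kernel_ge0.
- by move=> z /=; rewrite !in_itv/= andbT => /andP[].
Qed.

Lemma small_powR (c t : R) : 0 <= c -> 0 < t ->
  exists2 s, 0 < s & forall x, 0 < x <= s -> c * x `^ dl <= t.
Proof.
move=> c0 t0; apply/near0P.
have /cvgrPdist_le /(_ t t0) : (fun x => c * x `^ dl) x @[x --> 0^'+] --> (0 : R).
  rewrite -[X in _ --> X](mulr0 c); apply: cvgM; first exact: cvg_cst.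
  exact: powR_cvg0.
by apply: filterS => x; rewrite sub0r normrN; apply: le_trans; exact: ler_norm.
Qed.

(** The fragments below d contribute x^(mu - 1) times a truncation of the moment,
    with a density arbitrarily close to p0; the fragments above d and the truncated
    part of the moment contribute x^dl times as much. *)
Lemma gain_equivalent t : 0 < t -> exists2 s, 0 < s & forall x, 0 < x <= s ->
  (((p0 * I - t) * x `^ (mu - 1))%:E <= gain x)%E /\
  (gain x <= ((p0 * I + t) * x `^ (mu - 1))%:E)%E.
Proof.
move=> t0; have I1 : 0 < I + 1 by rewrite ltr_wpDl.
pose u := Num.min p0 (t / 2 / (I + 1)).
have u0 : 0 < u by rewrite lt_min p00 !divr_gt0.
have up0 : u <= p0 by rewrite ge_min lexx.
have uI : u * I <= t / 2.
  have : u <= t / 2 / (I + 1) by rewrite ge_min lexx orbT.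
  rewrite ler_pdivlMr//; apply: le_trans.
  by rewrite ler_wpM2l ?(ltW u0)// lerDl.
have [d [d0 de d1 qd]] := qp0 u0.
have cq1 z : 0 < z < d -> (p0 - u) * z `^ (mu - 1) <= q z.
  by move=> /qd; rewrite ler_distl mulrBl => /andP[].
have cq2 z : 0 < z < d -> q z <= (p0 + u) * z `^ (mu - 1).
  by move=> /qd; rewrite ler_distl mulrDl => /andP[].
have pu1 : 0 <= p0 - u by rewrite subr_ge0.
have pu2 : 0 <= p0 + u by rewrite addr_ge0// ltW.
have P00 : 0 <= P0 by rewrite fine_ge0.
pose c1 := p0 * (M * (d `^ (- dl) / dl)).
pose c2 := M * d `^ (- dl - mu) * P0.
have c10 : 0 <= c1 by rewrite !mulr_ge0 ?powR_ge0 ?invr_ge0 ?(ltW dl0) ?(ltW p00).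
have c20 : 0 <= c2 by rewrite !mulr_ge0 ?powR_ge0.
have t20 : 0 < t / 2 by rewrite divr_gt0.
have [s1 s10 Hs1] := small_powR c10 t20.
have [s2 s20 Hs2] := small_powR c20 t20.
exists (Num.min (d * r) (Num.min s1 s2)); first by rewrite !lt_min mulr_gt0//= s10.
move=> x /andP[x0]; rewrite !le_min => /andP[xdr /andP[xs1 xs2]].
have Rdx : r^-1 <= d / x by rewrite ler_pdivlMr// mulrC ler_pdivrMr.
have X0 : 0 <= x `^ (mu - 1) by exact: powR_ge0.
have xE : x `^ (dl - 1) * x `^ mu = x `^ dl * x `^ (mu - 1).
  by rewrite -!powRDp//; congr powR; ring.
split.
- apply: le_trans (gain_ge mh h0 mq q0 pq d0 de d1 pu1 x0 cq1).
  have Kf : K mu (d / x) \is a fin_num.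
    by rewrite ge0_fin_numE ?truncated_moment_ge0// Kfin// divr_gt0.
  have := total_moment_le Rdx; rewrite IE -(fineK Kf) -EFinD -EFinM !lee_fin.
  set k := fine _ => Ik; rewrite mulrAC ler_wpM2r//.
  have dxE : (d / x) `^ (- dl) = d `^ (- dl) * x `^ dl.
    rewrite powRM ?invr_ge0 ?(ltW d0) ?(ltW x0)//; congr (_ * _).
    by rewrite -powR_inv1 ?(ltW x0)// -powRrM mulrNN mul1r.
  have c1x : c1 * x `^ dl <= t / 2 by apply: Hs1; rewrite x0.
  have T0 : 0 <= M * ((d / x) `^ (- dl) / dl).
    by rewrite mulr_ge0// divr_ge0 ?powR_ge0// ltW.
  have : (p0 - u) * (I - M * ((d / x) `^ (- dl) / dl)) <= (p0 - u) * k.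
    by rewrite ler_wpM2l// lerBlDr.
  apply: le_trans.
  have : (p0 - u) * (M * ((d / x) `^ (- dl) / dl)) <= c1 * x `^ dl.
    rewrite /c1 -mulrA; apply: ler_pM => //; first by rewrite lerBlDr lerDl ltW.
    by rewrite -mulrA ler_wpM2l// dxE mulrAC.
  by rewrite mulrBr mulrBl; lra.
- have Hm z : d <= z <= 1 ->
      h (x / z) / z <= M * 1 * d `^ (- dl - mu) * x `^ (dl - 1) * (x `^ mu + 0).
    move=> dz; apply: gain_mid_le => //; [exact: ltW|exact: ltW|].
    move=> y /andP[xy yxd]; rewrite mul1r addr0; apply: hM.
    rewrite (lt_le_trans x0 xy)/=; apply: le_trans yxd _.
    by rewrite ler_pdivrMr// mulrC.
  apply: le_trans (gain_le mh h0 mq q0 pq d0 de d1 pu2 x0 cq2 Hm) _.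
  apply: (@le_trans _ _ (((p0 + u) * x `^ (mu - 1))%:E * I%:E + _)%E).
    by apply: leeD (lexx _); apply: lee_wpmul2l; rewrite ?lee_fin ?mulr_ge0//.
  rewrite -EFinM -EFinD lee_fin mulr1 addr0.
  have -> : M * d `^ (- dl - mu) * x `^ (dl - 1) * x `^ mu * P0 =
      c2 * x `^ dl * x `^ (mu - 1).
    by rewrite -(mulrA _ (x `^ (dl - 1))) xE /c2; ring.
  have H : c2 * x `^ dl <= t / 2 by apply: Hs2; rewrite x0.
  rewrite [(p0 + u) * _ * I]mulrAC -mulrDl ler_wpM2r// mulrDl.
  by move: H uI; lra.
Qed.

End gain_equivalent.

(** If the moment vanished, h would vanish almost everywhere. *)
Lemma total_moment_gt0 (R : realType) (h : R -> R) (mu a c : R) :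
  measurable_fun setT h -> (forall y, 0 <= h y) -> 0 < a -> a < c ->
  (forall y, a < y < c -> 0 < h y) -> (0 < total_moment h mu)%E.
Proof.
move=> mh h0 a0 ac hac; rewrite lt_neqAle total_moment_ge0// andbT.
apply/negP => /eqP/esym I0.
have c0 : 0 < c by exact: lt_trans ac.
have mD : measurable ([set` `]0, +oo[] : set R) by exact: measurable_itv.
have mk : measurable_fun (`]0, +oo[ : set R) (fun w => (moment_kernel h mu w)%:E).
  apply/measurable_EFinP; apply: measurable_fun_moment_kernel => //.
  by move=> z /=; rewrite !in_itv/= !andbT => /ltW.
have /(ae_eq_integral_abs lebesgue_measure mD mk) :
   (\int[lebesgue_measure]_(w in `]0%R, +oo[) `|(moment_kernel h mu w)%:E| = 0)%E.
  rewrite -I0; apply: eq_integral => w _.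
  by rewrite gee0_abs// lee_fin moment_kernel_ge0.
move=> [N [mN N0 sN]].
suff : (lebesgue_measure (`]c^-1%R, a^-1%R[%classic : set R) <= lebesgue_measure N)%E.
  rewrite [X in (_ <= X)%E]N0 lebesgue_measure_itv/= lte_fin ltf_pV2 ?posrE// ac.
  by rewrite -EFinB lee_fin subr_le0 leNgt ltf_pV2 ?posrE// ac.
apply: le_measure; rewrite ?inE//.
move=> w /=; rewrite in_itv/= => /andP[cw wa]; apply: sN => /= H.
have w0 : 0 < w by apply: lt_trans cw; rewrite invr_gt0.
have := H; rewrite in_itv/= w0 => /(_ isT) /(congr1 fine)/= /eqP.
rewrite mulf_eq0 !gt_eqF ?powR_gt0// hac//.
by rewrite invf_pgt ?posrE// wa/= invf_plt ?posrE// cw.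
Qed.

(** * Asymptotic solution of the linear equation *)

Lemma littleo_near0P (R : realType) (f g e : R -> R) :
  f = g +o_ (0^'+) e <->
  forall t, 0 < t -> exists2 r, 0 < r & forall x, 0 < x <= r -> `|f x - g x| <= t * `|e x|.
Proof.
split=> [/eqaddoP H t t0|H]; first by apply/near0P; exact: H.
by apply/eqaddoP => t t0; apply/near0P; exact: H.
Qed.

Lemma equiv_powR_cvg (R : realType) (f : R -> R) (c s : R) :
  f ~_(0^'+) (fun x => c * x `^ s) -> f x / x `^ s @[x --> 0^'+] --> c.
Proof.
move=> /littleo_near0P H; apply/cvgrPdist_le => t t0.
have c1 : 0 < `|c| + 1 by rewrite ltr_wpDl.
have [r r0 Hr] := H (t / (`|c| + 1)) (divr_gt0 t0 c1).
apply/near0P; exists r => // x /[dup] xr /andP[x0 _].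
have X0 : 0 < x `^ s by exact: powR_gt0.
have -> : c - f x / x `^ s = (c * x `^ s - f x) / x `^ s by field; rewrite gt_eqF.
rewrite normrM normfV (gtr0_norm X0) ler_pdivrMr// distrC.
apply: le_trans (Hr x xr) _; rewrite normrM (gtr0_norm X0) mulrA ler_wpM2r ?(ltW X0)//.
by rewrite mulrAC ler_pdivrMr// ler_wpM2l ?(ltW t0)// lerDl.
Qed.

Lemma cvg_equiv_powR (R : realType) (f : R -> R) (c s : R) : 0 < c ->
  f x / x `^ s @[x --> 0^'+] --> c -> f ~_(0^'+) (fun x => c * x `^ s).
Proof.
move=> c0 /cvgrPdist_le H; apply/littleo_near0P => t t0.
have /near0P[r r0 Hr] := H (t * c) (mulr_gt0 t0 c0).
exists r => // x /[dup] /Hr{}Hr /andP[x0 _].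
have X0 : 0 < x `^ s by exact: powR_gt0.
have -> : f x - c * x `^ s = - (c - f x / x `^ s) * x `^ s by field; rewrite gt_eqF.
by rewrite !normrM normrN (gtr0_norm X0) (gtr0_norm c0) mulrA ler_wpM2r// ltW.
Qed.

(** On x^beta the operator F' + A F is equivalent to m x^(mu - 1). Hence, since N is
    equivalent to c x^(mu - 1), the multiple k x^beta is a supersolution of the
    equation F' + A F = N near 0 if k > c / m and a subsolution if k < c / m. *)
Lemma linear_ode_equivalent (R : realType) (F A : R -> R) (N : R -> \bar R)
    (c mu beta m : R) :
  locally_abs_continuous F -> F x @[x --> 0^'+] --> (0 : R) ->
  0 < beta -> 0 < c -> 0 < m -> (forall x, 0 < x -> 0 <= A x) ->
  {ae lebesgue_measure, forall x : R, 0 < x ->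
    derivable F x 1 /\ N x = (derive1 F x + A x * F x)%:E} ->
  (forall t, 0 < t -> exists2 s, 0 < s & forall x, 0 < x <= s ->
    (((c - t) * x `^ (mu - 1))%:E <= N x)%E /\
    (N x <= ((c + t) * x `^ (mu - 1))%:E)%E) ->
  beta * x `^ (beta - mu) + A x * x `^ (beta - mu + 1) @[x --> 0^'+] --> m ->
  F x / x `^ beta @[x --> 0^'+] --> c / m.
Proof.
move=> acF F0 beta0 c0 m0 A0 eqF HN Hm; apply/cvgrPdist_le => t t0.
pose k := c / m.
have k0 : 0 < k by rewrite divr_gt0.
have km : k * m = c by rewrite /k divfK// gt_eqF.
have kt0 : 0 < k + t by rewrite addr_gt0.
(* s is the error allowed on m: multiplied by k + t >= |k - t| it costs t m / 2. *)
pose s := t * m / (2 * (k + t)).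
have s0 : 0 < s by rewrite !(divr_gt0, mulr_gt0).
have skt : s * (k + t) = t * m / 2 by rewrite /s; field; rewrite gt_eqF.
have tm0 : 0 < t * m / 2 by rewrite !(divr_gt0, mulr_gt0).
have [r1 r10 H1] := HN _ tm0.
have /near0P[r2 r20 H2] : \forall x \near 0^'+,
    `|m - (beta * x `^ (beta - mu) + A x * x `^ (beta - mu + 1))| <= s.
  by move/cvgrPdist_le : Hm => /(_ s s0).
pose r := Num.min r1 r2.
have r0 : 0 < r by rewrite lt_min r10.
pose L (x : R) := beta * x `^ (beta - 1) + A x * x `^ beta.
have LE x : 0 < x <= r -> (m - s) * x `^ (mu - 1) <= L x <= (m + s) * x `^ (mu - 1).
  move=> /andP[x0]; rewrite le_min => /andP[_ xr2].
  have := H2 x; rewrite x0 xr2 => /(_ isT); rewrite distrC ler_distl => /andP[l1 l2].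
  have -> : L x = (beta * x `^ (beta - mu) + A x * x `^ (beta - mu + 1)) * x `^ (mu - 1).
    rewrite mulrDl -!mulrA -!powRDp// /L.
    by congr (_ * _ `^ _ + _ * _ `^ _); ring.
  by rewrite !ler_wpM2r ?powR_ge0.
apply/near0P; exists r => // x /[dup] xr /andP[x0 _].
have X0 : 0 < x `^ beta by exact: powR_gt0.
suff [lo up] : (k - t) * x `^ beta <= F x /\ F x <= (k + t) * x `^ beta.
  by rewrite distrC ler_distl ler_pdivlMr// lo ler_pdivrMr.
have G0 y : 0 < y <= r ->
    ((k - t) * L y <= (c - t * m / 2) * y `^ (mu - 1) /\
     (c + t * m / 2) * y `^ (mu - 1) <= (k + t) * L y).
  move=> yr; have Y0 : 0 <= y `^ (mu - 1) by exact: powR_ge0.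
  have /andP[l1 l2] := LE y yr; split.
    have [kt|kt] := leP 0 (k - t).
      apply: le_trans (ler_wpM2l kt l2) _; rewrite mulrA ler_wpM2r//.
      have : s * (k - t) <= s * (k + t) by rewrite ler_wpM2l ?(ltW s0)//; lra.
      have -> : (k - t) * (m + s) = k * m - t * m + s * (k - t) by ring.
      by rewrite skt km; lra.
    apply: le_trans (ler_wnM2l (ltW kt) l1) _; rewrite mulrA ler_wpM2r//.
    have : s * (t - k) <= s * (k + t) by rewrite ler_wpM2l ?(ltW s0)//; lra.
    have -> : (k - t) * (m - s) = k * m - t * m + s * (t - k) by ring.
    by rewrite skt km; lra.
  apply: le_trans (ler_wpM2l (ltW kt0) l1); rewrite mulrA ler_wpM2r//.
  have -> : (k + t) * (m - s) = k * m + t * m - s * (k + t) by ring.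
  by rewrite skt km; lra.
have Neq y : 0 < y < r -> N y = (derive1 F y + A y * F y)%:E ->
   (c - t * m / 2) * y `^ (mu - 1) <= derive1 F y + A y * F y /\
   derive1 F y + A y * F y <= (c + t * m / 2) * y `^ (mu - 1).
  move=> /andP[y0 yr] NE; have := H1 y; rewrite y0/= NE !lee_fin => -[]//.
  by apply: le_trans (ltW yr) _; rewrite ge_min lexx.
split.
- have acN : locally_abs_continuous (fun x => - F x).
    by move=> u v u0 uv; apply: abs_continuousN; exact: acF.
  have FN0 : - F x @[x --> 0^'+] --> (0 : R) by rewrite -[X in _ --> X]oppr0; exact: cvgN.
  have := @comparison_powR R r (fun x => - F x) (- (k - t)) beta 0 1 beta0 ltr01 acN FN0.
  move=> /(_ _ x xr); rewrite mul0r addr0 mulNr lerN2; apply.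
  apply: ae_imply eqF => y H /[dup] yr /andP[y0 yr'].
  have yr2 : 0 < y <= r by rewrite y0 ltW.
  rewrite mul0r addr0 mulNr ltrN2 => Fy; have [dF NE] := H y0.
  have dN := is_deriveN (DeriveDef dF (esym (derive1E F y))).
  split; first by case: dN.
  rewrite derive1E (@derive_val _ _ _ _ _ _ _ dN) mul0r addr0 mulNr lerN2.
  have [Gl _] := G0 y yr2; have [N1 _] := Neq y yr NE.
  have := le_trans Gl N1; rewrite /L mulrDr => H3.
  have : A y * F y <= (k - t) * (A y * y `^ beta).
    by rewrite mulrCA ler_wpM2l ?A0// ltW.
  by lra.
- have := @comparison_powR R r F (k + t) beta 0 1 beta0 ltr01 acF F0.
  move=> /(_ _ x xr); rewrite mul0r addr0; apply.
  apply: ae_imply eqF => y H /[dup] yr /andP[y0 yr'].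
  have yr2 : 0 < y <= r by rewrite y0 ltW.
  rewrite mul0r addr0 => Fy; have [dF NE] := H y0.
  split => //; rewrite mul0r addr0.
  have [_ Gu] := G0 y yr2; have [_ N2] := Neq y yr NE.
  have := le_trans N2 Gu; rewrite /L mulrDr => H3.
  have : (k + t) * (A y * y `^ beta) <= A y * F y.
    by rewrite mulrCA ler_wpM2l ?A0// ltW.
  by lra.
Qed.

(** * The profile near 0 *)

(** Factoring out the equivalents of B and tau leaves explicit powers of x. *)
Lemma cvg_scaled_rate (R : realType) (B tau : R -> R) (l B0 tau0 g0 a0 k u v : R) :
  0 < tau0 -> (forall x, 0 < x -> 0 < tau x) ->
  B x / x `^ g0 @[x --> 0^'+] --> B0 -> tau x / x `^ a0 @[x --> 0^'+] --> tau0 ->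
  x `^ (k - a0) @[x --> 0^'+] --> u -> x `^ (g0 + k - a0) @[x --> 0^'+] --> v ->
  (l + B x) / tau x * x `^ k @[x --> 0^'+] --> (l * u + B0 * v) / tau0.
Proof.
move=> tau00 tau_gt0 cB ct cu cv.
have H : (l * x `^ (k - a0) + B x / x `^ g0 * x `^ (g0 + k - a0)) / (tau x / x `^ a0)
    @[x --> 0^'+] --> (l * u + B0 * v) / tau0.
  apply: cvgM; last by apply: cvgV => //; rewrite gt_eqF.
  by apply: cvgD; apply: cvgM => //; exact: cvg_cst.
apply: cvg_trans H; apply: near_eq_cvg; apply/near0P; exists 1 => // x /andP[x0 _].
have t0 := tau_gt0 x x0.
have -> : x `^ (k - a0) = x `^ k / x `^ a0 by rewrite powRDp// powRN.
have -> : x `^ (g0 + k - a0) = x `^ g0 * x `^ k / x `^ a0 by rewrite !powRDp// powRN.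
by field; rewrite !gt_eqF ?powR_gt0.
Qed.

Section profile.
Context (R : realType) (B tau : R -> R)
  (p : {finite_measure set (measurableTypeR R) -> \bar R})
  (B0 Binf tau0 tauinf gamma0 gamma alpha0 alpha p0 mu : R)
  (setting : growth_frag_setting B tau p
               B0 Binf tau0 tauinf gamma0 gamma alpha0 alpha p0 mu)
  (p0_gt0 : 0 < p0) (lambda : R) (G phi : R -> R)
  (sol : eigen_solution B tau p lambda G phi).

Let F (x : R) := tau x * G x.
Let A (x : R) := (lambda + B x) / tau x.
(** Extended by 0 so as to be measurable on the whole line. *)
Let h : R -> R := (fun x => B x * G x) \_ `]0, +oo[.

Let tau_gt0 x : 0 < x -> 0 < tau x. Proof. exact: (gf_tau_gt0 setting). Qed.
Let B_gt0 x : 0 < x -> 0 < B x. Proof. exact: (gf_B_gt0 setting). Qed.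
Let G_ge0 x : 0 < x -> 0 <= G x. Proof. exact: (es_G_ge0 sol). Qed.
Let acF : locally_abs_continuous F. Proof. exact: (es_G_ac sol). Qed.
Let F0 : F x @[x --> 0^'+] --> (0 : R). Proof. exact: (es_G_at0 sol). Qed.

Let hE x : 0 < x -> h x = B x * G x.
Proof. by move=> x0; rewrite /h patchE mem_set//= in_itv/= x0. Qed.

Let h_ge0 x : 0 <= h x.
Proof.
rewrite /h patchE; case: ifPn => //; rewrite inE/= in_itv/= andbT => x0.
by rewrite mulr_ge0 ?G_ge0// ltW// B_gt0.
Qed.

Lemma profile_continuous x : 0 < x -> {for x, continuous G}.
Proof.
move=> x0; have cF := ac_continuous acF x0; have ct := gf_tau_cont setting x0.
have H : F y / tau y @[y --> x] --> F x / tau x.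
  by apply: cvgM cF _; apply: cvgV => //; rewrite gt_eqF ?tau_gt0.
have E : F x / tau x = G x by rewrite /F; field; rewrite gt_eqF ?tau_gt0.
suff : G y @[y --> x] --> F x / tau x by rewrite E.
apply: cvg_trans H; apply: near_eq_cvg.
near=> y; have y0 : 0 < y by near: y; exact: lt_nbhsr.
by rewrite /F; field; rewrite gt_eqF ?tau_gt0.
Unshelve. all: by end_near. Qed.

Let mh : measurable_fun setT h.
Proof.
have mI : measurable ([set` `]0, +oo[] : set R) by exact: measurable_itv.
have [mB _ _] := gf_B_loc setting.
apply/(measurable_restrictT _ mI); apply: measurable_funM => //.
apply: open_continuous_measurable_fun; first exact: interval_open.
by move=> x; rewrite inE/= in_itv/= andbT; exact: profile_continuous.
Qed.

Let gainE x : 0 < x -> frag_gain B p G x = total_gain p h x.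
Proof.
move=> x0; apply: eq_integral => z; rewrite inE/= in_itv/= => /andP[z0 _].
congr EFin; have [->|zn0] := eqVneq z 0; first by rewrite invr0 !mulr0.
by rewrite hE// divr_gt0// lt_neqAle eq_sym zn0.
Qed.

Let eqF : {ae lebesgue_measure, forall x : R, 0 < x ->
  derivable F x 1 /\ total_gain p h x = (derive1 F x + A x * F x)%:E}.
Proof.
apply: ae_imply (es_G_eq sol) => x H x0; have [dF] := H x0.
split=> //; move: b; rewrite /frag_op gainE// -/F.
have -> : A x * F x = lambda * G x + B x * G x.
  by rewrite /A /F; field; rewrite gt_eqF ?tau_gt0.
case: (total_gain p h x) => [s| |]//=; rewrite -EFinB => -[E].
by congr EFin; rewrite addrA E subrK.
Qed.

Let positive_on_itv : exists a c, [/\ 0 < a, a < c & forall y, a < y < c -> 0 < h y].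
Proof.
have [x0 x00 Gx0] : exists2 x, 0 < x & 0 < G x.
  apply: contrapT => H.
  have : (\int[lebesgue_measure]_(x in `]0%R, +oo[) (G x)%:E = 0)%E.
    apply: integral0_eq => x /=; rewrite in_itv/= andbT => x0; congr EFin.
    apply/eqP; rewrite eq_le G_ge0// andbT leNgt; apply/negP => Gx; apply: H.
    by exists x.
  by rewrite (es_G_mass sol) => -[] /eqP; rewrite oner_eq0.
have /cvgrPdist_lt /(_ (G x0) Gx0) [r /= r0 Hr] := profile_continuous x00.
pose a := Num.max (x0 - r) (x0 / 2).
have ax0 : a < x0.
  by rewrite gt_max ltrBlDr ltrDl r0/= ltr_pdivrMr// ltr_pMr// ltr1n.
exists a, x0; split => //; first by rewrite lt_max divr_gt0// orbT.
move=> y /andP[ay yx0]; have [xry xy] : x0 - r < y /\ x0 / 2 < y.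
  by move: ay; rewrite gt_max => /andP.
have y0 : 0 < y by apply: lt_trans xy; rewrite divr_gt0.
rewrite hE// mulr_gt0 ?B_gt0//.
have := Hr y; rewrite /ball/= ger0_norm ?subr_ge0 ?(ltW yx0)// ltrBlDr -ltrBlDl.
move=> /(_ xry) /ltr_normlW; lra.
Qed.

Let rho x : 0 < x -> 0 <= A x.
Proof.
by move=> x0; rewrite divr_ge0 ?ltW ?tau_gt0// addr_gt0 ?B_gt0// (es_lambda_gt0 sol).
Qed.

Let cB : B x / x `^ gamma0 @[x --> 0^'+] --> B0.
Proof. exact: equiv_powR_cvg (gf_B_at0 setting). Qed.

Let ctau : tau x / x `^ alpha0 @[x --> 0^'+] --> tau0.
Proof. exact: equiv_powR_cvg (gf_tau_at0 setting). Qed.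

Let tau00 : 0 < tau0. Proof. exact: (gf_tau0_gt0 setting). Qed.
Let mu0 : 0 < mu. Proof. exact: (gf_mu_gt0 setting). Qed.

(** B / tau is of order x^(gamma0 - alpha0), whose exponent exceeds - 1; the bound eta
    <= mu costs nothing because powers of x < 1 decrease with the exponent. *)
Lemma fragmented_mass_le : exists eta b r, [/\ 0 < eta, eta <= mu, 0 <= b, 0 < r &
  forall y, 0 < y <= r -> h y <= b * y `^ (eta + eta - 1) * F y].
Proof.
pose eta := Num.min ((gamma0 - alpha0 + 1) / 2) mu.
have eta0 : 0 < eta by rewrite lt_min mu0 divr_gt0// (gf_exp_at0 setting).
have etag : eta + eta - 1 <= gamma0 - alpha0.
  have : eta <= (gamma0 - alpha0 + 1) / 2 by rewrite ge_min lexx.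
  by lra.
have B00 : 0 < B0 by exact: (gf_B0_gt0 setting).
have c0 : 0 < B0 / tau0 + 1 by rewrite addr_gt0// divr_gt0.
have H : (B x / x `^ gamma0) / (tau x / x `^ alpha0) @[x --> 0^'+] --> B0 / tau0.
  by apply: cvgM => //; apply: cvgV => //; rewrite gt_eqF.
have /near0P[r r0 Hr] : \forall x \near 0^'+,
    (B x / x `^ gamma0) / (tau x / x `^ alpha0) <= B0 / tau0 + 1.
  move/cvgrPdist_le : H => /(_ 1 ltr01); apply: filterS => x.
  by rewrite distrC ler_distl => /andP[].
exists eta, (B0 / tau0 + 1), (Num.min r 1); split => //.
- by rewrite ge_min lexx orbT.
- exact: ltW.
- by rewrite lt_min r0 ltr01.
- move=> y /andP[y0]; rewrite le_min => /andP[yr y1]; rewrite hE//.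
  have Y0 : 0 <= F y by rewrite mulr_ge0 ?G_ge0// ltW// tau_gt0.
  have -> : B y * G y =
      (B y / y `^ gamma0) / (tau y / y `^ alpha0) * y `^ (gamma0 - alpha0) * F y.
    rewrite powRDp// powRN /F; field.
    by rewrite !gt_eqF ?tau_gt0 ?powR_gt0.
  rewrite ler_wpM2r//; apply: ler_pM; rewrite ?powR_ge0//.
  + by rewrite !divr_ge0 ?powR_ge0// ltW// ?B_gt0 ?tau_gt0.
  + by apply: Hr; rewrite y0.
  + by apply: ger_powR; rewrite ?y0.
Qed.

(** The constant is p0 times the moment of order - mu of B G. *)
Lemma gain_asymptotics : exists2 c, 0 < c & forall t, 0 < t -> exists2 s, 0 < s &
  forall x, 0 < x <= s ->
  (((c - t) * x `^ (mu - 1))%:E <= total_gain p h x)%E /\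
  (total_gain p h x <= ((c + t) * x `^ (mu - 1))%:E)%E.
Proof.
have [e e0 [q [mq q0 pq qeq]]] := gf_p_at0 setting.
have qequiv := (littleo_near0P _ _ _).1 qeq.
have q0' z : 0 <= z < e -> 0 <= q z by exact: q0.
have qp t : 0 < t -> exists d, [/\ 0 < d, d <= e, d <= 1 &
    forall z, 0 < z < d -> `|q z - p0 * z `^ (mu - 1)| <= t * z `^ (mu - 1)].
  move=> t0; have [r r0 Hr] := qequiv t t0.
  exists (Num.min r (Num.min e 1)); split.
  - by rewrite !lt_min r0 e0/=.
  - by rewrite !ge_min lexx orbT.
  - by rewrite !ge_min lexx !orbT.
  - move=> z /andP[z0]; rewrite lt_min => /andP[zr _].
    apply: le_trans (Hr z _) _; first by rewrite z0 ltW.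
    by rewrite ger0_norm ?powR_ge0.
have [eta [b [r1 [eta0 etamu b0 r10 hF]]]] := fragmented_mass_le.
have p20 : 0 < p0 / 2 by rewrite divr_gt0.
have [d [d0 de d1 qd]] := qp _ p20.
have cq1 z : 0 < z < d -> p0 / 2 * z `^ (mu - 1) <= q z.
  by move=> /qd; rewrite ler_distl => /andP[+ _]; apply: le_trans; rewrite -mulrBl; lra.
have cq2 z : 0 < z < d -> q z <= 2 * p0 * z `^ (mu - 1).
  move=> /[dup] /andP[z0 _] /qd; rewrite ler_distl => /andP[_ /le_trans]; apply.
  by rewrite -mulrDl ler_wpM2r ?powR_ge0//; lra.
have p2_ge0 : 0 <= 2 * p0 by rewrite mulr_ge0// ltW.
have Fge0 x : 0 < x -> 0 <= F x by move=> x0; rewrite mulr_ge0 ?G_ge0// ltW// tau_gt0.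
have Feq : {ae lebesgue_measure, forall x : R, 0 < x ->
  [/\ derivable F x 1, (total_gain p h x < +oo)%E &
      ((derive1 F x)%:E <= total_gain p h x)%E]}.
  apply: ae_imply eqF => x H x0; have [dF ->] := H x0; split => //; first exact: ltry.
  by rewrite lee_fin lerDl mulr_ge0 ?rho// Fge0.
have [S [r [S0 r0 FS]]] := profile_le_powR mh h_ge0 mq q0' pq eta0 etamu b0 r10 acF F0
  Fge0 hF d0 de d1 p20 p2_ge0 cq1 cq2 Feq.
have Kfin W : 0 < W -> (truncated_moment h mu W < +oo)%E.
  move=> W0; have := truncated_moment_fin mh h_ge0 mq q0' pq d0 de d1 p20 cq1 Feq W0.
  by rewrite ge0_fin_numE// truncated_moment_ge0.
have bS0 : 0 <= b * S by rewrite mulr_ge0.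
have rr0 : 0 < Num.min r1 r by rewrite lt_min r10.
have ee0 : 0 < eta + eta by rewrite addr_gt0.
have hM y : 0 < y <= Num.min r1 r ->
    h y <= b * S * y `^ (eta + eta - 1) * y `^ mu.
  move=> /andP[y0]; rewrite le_min => /andP[yr1 yr].
  apply: le_trans (hF y _) _; first by rewrite y0.
  rewrite [b * S * _]mulrAC -[leRHS]mulrA.
  by rewrite ler_wpM2l ?mulr_ge0 ?powR_ge0// FS// y0.
have [a [c [a0 ac hac]]] := positive_on_itv.
have Ipos := total_moment_gt0 mu mh h_ge0 a0 ac hac.
have Ifin := total_moment_lty mh h_ge0 ee0 bS0 rr0 hM Kfin.
exists (p0 * fine (total_moment h mu)); first by rewrite mulr_gt0// fine_gt0// Ipos.
exact: (gain_equivalent mh h_ge0 mq q0' pq mu0 ee0 bS0 rr0 p0_gt0 hM qp Kfin).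
Qed.

(** It remains to find the exponent beta for which the left-hand side of the equation
    for tau G, evaluated at x^beta, is of the order x^(mu - 1) of the gain. *)
Lemma profile_equivalent (beta m : R) : 0 < beta -> 0 < m ->
  beta * x `^ (beta - mu) + A x * x `^ (beta - mu + 1) @[x --> 0^'+] --> m ->
  exists2 C : R, 0 < C & G ~_(0^'+) (fun x => C * x `^ (beta - alpha0)).
Proof.
move=> beta0 m0 cm; have [c c0 cN] := gain_asymptotics.
have cF := linear_ode_equivalent acF F0 beta0 c0 m0 rho eqF cN cm.
exists (c / m / tau0); first by rewrite !divr_gt0.
apply: cvg_equiv_powR; first by rewrite !divr_gt0.
have H : (F x / x `^ beta) / (tau x / x `^ alpha0) @[x --> 0^'+] --> c / m / tau0.
  by apply: cvgM => //; apply: cvgV => //; rewrite gt_eqF.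
apply: cvg_trans H; apply: near_eq_cvg; apply/near0P; exists 1 => // x /andP[x0 _].
rewrite powRDp// powRN /F; field.
by rewrite !gt_eqF ?tau_gt0 ?powR_gt0.
Qed.

(** For beta = mu the derivative dominates: (lambda + B) / tau is integrable at 0. *)
Lemma profile_equivalent_lt1 : alpha0 < 1 ->
  exists2 C : R, 0 < C & G ~_(0^'+) (fun x => C * x `^ (mu - alpha0)).
Proof.
move=> a1; apply: (profile_equivalent mu0 mu0).
rewrite -[X in _ --> X]addr0; apply: cvgD.
  rewrite subrr -[X in _ --> X]mulr1.
  by apply: cvgM; [exact: cvg_cst|under eq_fun do rewrite powRr0; exact: cvg_cst].
rewrite subrr add0r.
rewrite [X in _ --> X](_ : 0 = (lambda * 0 + B0 * 0) / tau0); last first.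
  by rewrite !mulr0 addr0 mul0r.
apply: (cvg_scaled_rate tau00 tau_gt0 cB ctau); apply: powR_cvg0; first by rewrite subr_gt0.
by have := gf_exp_at0 setting; lra.
Qed.

(** For beta = mu - 1 + alpha0 the term lambda G balances the gain, B tends to 0, and
    the derivative contributes at the same order only if alpha0 = 1. *)
Lemma profile_equivalent_ge1 : 1 <= alpha0 ->
  exists2 C : R, 0 < C & G ~_(0^'+) (fun x => C * x `^ (mu - 1)).
Proof.
move=> a1; have g0 := gf_exp_at0 setting.
have beta0 : 0 < mu - 1 + alpha0 by move: mu0; lra.
have l0 : 0 < lambda by exact: (es_lambda_gt0 sol).
have clt : A x * x `^ alpha0 @[x --> 0^'+] --> lambda / tau0.
  have -> : lambda / tau0 = (lambda * 1 + B0 * 0) / tau0 by rewrite mulr0 addr0 mulr1.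
  apply: (cvg_scaled_rate tau00 tau_gt0 cB ctau).
    by rewrite subrr; under eq_fun do rewrite powRr0; exact: cvg_cst.
  by apply: powR_cvg0; lra.
have [m m0 cm] : exists2 m : R, 0 < m &
    (mu - 1 + alpha0) * x `^ (mu - 1 + alpha0 - mu) +
    A x * x `^ (mu - 1 + alpha0 - mu + 1) @[x --> 0^'+] --> m.
  have -> : mu - 1 + alpha0 - mu + 1 = alpha0 by ring.
  have -> : mu - 1 + alpha0 - mu = alpha0 - 1 by ring.
  move: a1; rewrite le_eqVlt => /predU1P[a1|a1].
  - exists ((mu - 1 + alpha0) * 1 + lambda / tau0).
      by rewrite mulr1 addr_gt0// divr_gt0.
    apply: cvgD => //; rewrite -a1 subrr; apply: cvgM; first exact: cvg_cst.
    by under eq_fun do rewrite powRr0; exact: cvg_cst.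
  - exists ((mu - 1 + alpha0) * 0 + lambda / tau0).
      by rewrite mulr0 add0r divr_gt0.
    apply: cvgD => //; apply: cvgM; first exact: cvg_cst.
    by apply: powR_cvg0; rewrite subr_gt0.
have := profile_equivalent beta0 m0 cm.
by have -> : mu - 1 + alpha0 - alpha0 = mu - 1 by rewrite addrK.
Qed.

End profile.

Theorem theorem1p8 (R : realType) (B tau : R -> R)
    (p : {finite_measure set (measurableTypeR R) -> \bar R})
    (B0 Binf tau0 tauinf gamma0 gamma alpha0 alpha p0 mu : R)
    (setting : growth_frag_setting B tau p
                 B0 Binf tau0 tauinf gamma0 gamma alpha0 alpha p0 mu)
    (p0_gt0 : 0 < p0)
    (lambda : R) (G phi : R -> R)
    (sol : eigen_solution B tau p lambda G phi) :
  (alpha0 < 1 ->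
    exists2 C : R, 0 < C & G ~_ (0^'+) (fun x => C * x `^ (mu - alpha0))) /\
  (1 <= alpha0 ->
    exists2 C : R, 0 < C & G ~_ (0^'+) (fun x => C * x `^ (mu - 1))).
Proof.
split; first exact: (profile_equivalent_lt1 setting p0_gt0 sol).
exact: (profile_equivalent_ge1 setting p0_gt0 sol).
Qed.
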